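(* Let $k$ be an algebraically closed field of characteristic zero and let $q \in k$ be a root of unity of odd order $N > 1$. Then for all integers $n \ge 1$, $$\nu_n(u_q(\mathfrak{sl}_2)) = \frac{1}{\gcd(N,n)}\,\bigl|\nu_n(T_{N^2}(q^2))\bigr|^2.$$
   Context: For a finite-dimensional Hopf algebra $H$ with antipode $S$ and $n \ge 1$, $\nu_n(H) = \mathrm{Tr}(S \circ P_H^{(n-1)}: H \to H) \in k$, where $P_H^{(m)}$ is the $m$-th convolution power of $\mathrm{id}_H$ ($P_H^{(0)}(h) = \varepsilon(h)1$, $P_H^{(m)}(h) = h_{(1)}\cdots h_{(m)}$ for $m \ge 1$). $u_q(\mathfrak{sl}_2)$ is the Hopf algebra generated as an algebra by $E, F, K$ with relations $E^N = F^N = 0$, $K^N = 1$, $KE = q^2EK$, $KF = q^{-2}FK$, $EF - FE = (K - K^{N-1})/(q - q^{-1})$, with $\Delta(E) = E\otimes1 + K\otimes E$, $\Delta(F) = F\otimes K^{-1} + 1\otimes F$, $\Delta(K) = K\otimes K$. For a primitive $N$-th root of unity $\omega$, the Taft algebra $T_{N^2}(\omega)$ is the Hopf algebra generated as an algebra by $x, g$ with relations $x^N = 0$, $g^N = 1$, $gx = \omega xg$, with $\Delta(x) = x\otimes1 + g\otimes x$, $\Delta(g) = g\otimes g$. For $z = \sum_i a_i\omega_i \in k$ with $a_i \in \mathbb{Z}$ and $\omega_i$ roots of unity, $\overline{z} = \sum_i a_i\omega_i^{-1}$ (well defined in characteristic zero) and $|z|^2 = z\overline{z}$; indicators of finite-dimensional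 Hopf algebras over $k$ are elements of this form. *)

(* Defs.v *)
From HB Require Import structures.
From mathcomp Require Import all_boot all_order all_algebra all_field.
From mathcomp Require Import classical_sets.

Set Implicit Arguments.
Unset Strict Implicit.
Unset Printing Implicit Defensive.

Import GRing.Theory.
Local Open Scope ring_scope.

Section TensorProduct.
Variable k : fieldType.

(* U (x) V in coordinates: the matrix t stands for                            *)
(* \sum_i \sum_j t i j (u_i (x) v_j), where (u_i) and (v_j) are the bases     *)
(* vbasis {:U} and vbasis {:V}.                                               *)
Definition tensor (U V : vectType k) : vectType k :=
  'M[k]_(\dim {:U}, \dim {:V}).

Definition pure (U V : vectType k) (u : U) (v : V) : tensor U V :=
  \matrix_(i, j) (coord (vbasis {:U}) i u * coord (vbasis {:V}) j v).

(* For a bilinear f, this is the linear map with u (x) v |-> f u v. *)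
Definition tensor_lift (U V : vectType k) (W : lmodType k)
    (f : U -> V -> W) (t : tensor U V) : W :=
  \sum_i \sum_j (t : 'M_(_, _)) i j *: f (vbasis {:U})`_i (vbasis {:V})`_j.

Definition tensor_map (U V U' V' : vectType k) (f : U -> U') (g : V -> V') :
    tensor U V -> tensor U' V' :=
  tensor_lift (fun u v => pure (f u) (g v)).

Definition tensor_assoc (U V W : vectType k) :
    tensor (tensor U V) W -> tensor U (tensor V W) :=
  tensor_lift (fun t w => tensor_lift (fun u v => pure u (pure v w)) t).

Definition tensor_mul (A B : falgType k) (s t : tensor A B) : tensor A B :=
  tensor_lift
    (fun a b => tensor_lift (fun c d => pure (a * c) (b * d)) t) s.

Definition endo_trace (V : vectType k) (f : V -> V) : k :=
  \tr (\matrix_(i, j) coord (vbasis {:V}) j (f (vbasis {:V})`_i)).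

End TensorProduct.

(* Finite-dimensional Hopf algebras over k. *)
Record hopfAlgType (k : fieldType) := HopfAlg {
  hopf_sort :> falgType k;
  comul : {linear hopf_sort -> tensor hopf_sort hopf_sort};
  counit : {linear hopf_sort -> k^o};
  antipode : {linear hopf_sort -> hopf_sort};
  comulA : forall h, tensor_assoc (tensor_map comul idfun (comul h)) =
                     tensor_map idfun comul (comul h);
  counitl : forall h, tensor_lift (fun a b => counit a *: b) (comul h) = h;
  counitr : forall h, tensor_lift (fun a b => counit b *: a) (comul h) = h;
  comul1 : comul 1 = pure 1 1;
  comulM : forall a b, comul (a * b) = tensor_mul (comul a) (comul b);
  counit1 : counit 1 = 1;
  counitM : forall a b, counit (a * b) = counit a * counit b;
  antipodel : forall h,
    tensor_lift (fun a b => antipode a * b) (comul h) = (counit h)%:A;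
  antipoder : forall h,
    tensor_lift (fun a b => a * antipode b) (comul h) = (counit h)%:A
}.

Section Indicators.
Variables (k : fieldType) (H : hopfAlgType k).

Definition convolution (f g : H -> H) (h : H) : H :=
  tensor_lift (fun a b => f a * g b) (comul H h).

Fixpoint sweedler_power (m : nat) : H -> H :=
  if m is m'.+1 then convolution idfun (sweedler_power m')
  else fun h => (counit H h)%:A.

(* Only meaningful for n >= 1. *)
Definition indicator (n : nat) : k :=
  endo_trace (fun h => antipode H (sweedler_power n.-1 h)).

End Indicators.

Section Presentations.
Variables (k : fieldType) (N : nat).

Definition uqsl2_relations (q : k) (A : algType k) (E F K : A) : Prop :=
  [/\ E ^+ N = 0, F ^+ N = 0 & K ^+ N = 1] /\
  [/\ K * E = q ^+ 2 *: (E * K),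
      K * F = q ^- 2 *: (F * K) &
      E * F - F * E = (q - q^-1)^-1 *: (K - K ^+ N.-1)].

(* The second clause says that the relations are defining ones: every algebra *)
(* with three elements satisfying them is the target of a (necessarily        *)
(* unique) algebra morphism from H.                                           *)
Definition is_uqsl2 (q : k) (H : hopfAlgType k) (E F K : H) : Prop :=
  [/\ agenv <<[:: E; F; K]>>%VS = {:H}%VS,
      uqsl2_relations q E F K,
      forall (A : algType k) (E' F' K' : A), uqsl2_relations q E' F' K' ->
        exists phi : {lrmorphism H -> A},
          [/\ phi E = E', phi F = F' & phi K = K'] &
      [/\ comul H E = pure E 1 + pure K E,
          comul H F = pure F K^-1 + pure 1 F &
          comul H K = pure K K]].

Definition taft_relations (w : k) (A : algType k) (x g : A) : Prop :=
  [/\ x ^+ N = 0, g ^+ N = 1 & g * x = w *: (x * g)].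

Definition is_taft (w : k) (H : hopfAlgType k) (x g : H) : Prop :=
  [/\ agenv <<[:: x; g]>>%VS = {:H}%VS,
      taft_relations w x g,
      forall (A : algType k) (x' g' : A), taft_relations w x' g' ->
        exists phi : {lrmorphism H -> A}, phi x = x' /\ phi g = g' &
      comul H x = pure x 1 + pure g x /\ comul H g = pure g g].

End Presentations.

Section CyclotomicConjugation.
Variable k : fieldType.

Definition root_of_unity (w : k) : Prop := exists2 m : nat, (0 < m)%N & w ^+ m = 1.

Definition cyclotomic_conjugate (z zbar : k) : Prop :=
  exists s : seq (int * k),
    [/\ forall p, p \in s -> root_of_unity p.2,
        z = \sum_(p <- s) p.2 *~ p.1 &
        zbar = \sum_(p <- s) p.2^-1 *~ p.1].

(* In characteristic zero the conjugate does not depend on the way z is       *)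
(* written; z with no such expression is sent to the dummy value 0.           *)
Definition cyc_conj (z : k) : k := xget 0 (cyclotomic_conjugate z).

Definition cyc_normsq (z : k) : k := z * cyc_conj z.

End CyclotomicConjugation.

(* Main.v *)
(* Put x = E, y = FK, z = K and w = q^2.  Then z x = w x z, z y = w^-1 y z,
   y x = w x y + (polynomial in z), and x, y are both (1, z)-skew primitive; the
   Taft algebra is the degenerate case y = 0.  In the PBW basis x^a y^c z^i both
   the Sweedler powers and the antipode preserve the filtration by a + c, so only
   the coefficients on the diagonal of the associated graded algebra contribute
   to Tr (S o P^(n-1)).  There x and y behave independently: the diagonal
   coefficient at (a, c, i) is a sum over D, D' of a term in D built from w, times
   the same kind of term in D' built from w^-1, times w^(i(D - D')), subject to
   n i + D + D' = 0 mod N.  Because N is odd, summing over i decouples D from D'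
   up to the factor gcd(N, n), which leaves nu_n(T) times its conjugate. *)

Require Import Defs.
From HB Require Import structures.
From mathcomp Require Import all_boot all_order all_algebra all_solvable all_field.
From mathcomp Require Import ring zify.
From mathcomp Require classical_sets.
Import GRing.Theory.
Local Open Scope ring_scope.

Set Implicit Arguments.
Unset Strict Implicit.
Unset Printing Implicit Defensive.

(** * Tensors and convolution *)

(** Two obstacles shape the proof. A presentation bounds the algebra only from above: that the
    monomials [x^a y^c z^i] are independent, without which no trace can be read off, must be
    extracted from the universal property. The would-be left regular representation is therefore
    written down on a space with a formal basis, and the coordinates of [h] are those of its action
    on the vector standing for 1. One family serves both algebras: [y x = w x y + al (z^2 - 1)],
    [x^N = y^M = 0], [z^N = 1], with [M = N], [al = - q^2 / (q - q^-1)] for the quantum group and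
    [M = 1], [al = 0] for the Taft algebra. The other obstacle is conjugation, a mere choice among
    the values given by all expressions of a number, over a field that need not embed in the
    algebraic numbers. Its uniqueness rests on the irreducibility of cyclotomic polynomials, carried
    from [algC] to [k] by an integer resultant. Conjugating then means replacing [w] by [w^-1]
    termwise, which is exactly how [y] differs from [x]. *)

Definition bilinear_map (k : fieldType) (U V W : lmodType k)
    (f : U -> V -> W) : Prop :=
  (forall v, linear (f^~ v)) /\ (forall u, linear (f u)).

Section LinearFunctions.
Variables (k : fieldType) (U W : lmodType k) (f : U -> W).
Hypothesis f_lin : linear f.

Lemma linear_fun0 : f 0 = 0.
Proof. by rewrite -[0](subrr 0) -scaleN1r addrC f_lin scaleN1r addNr. Qed.

Lemma linear_funD u v : f (u + v) = f u + f v.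
Proof. by rewrite -[u in LHS]scale1r f_lin scale1r. Qed.

Lemma linear_funZ a u : f (a *: u) = a *: f u.
Proof. by rewrite -[a *: u]addr0 f_lin linear_fun0 addr0. Qed.

Lemma linear_fun_sum (I : Type) (r : seq I) (P : pred I) (F : I -> U) :
  f (\sum_(i <- r | P i) F i) = \sum_(i <- r | P i) f (F i).
Proof. exact: (big_morph f linear_funD linear_fun0). Qed.

Lemma linear_sumZ (I : Type) (r : seq I) (P : pred I) (c : I -> k) (F : I -> U) :
  f (\sum_(i <- r | P i) c i *: F i) = \sum_(i <- r | P i) c i *: f (F i).
Proof. by rewrite linear_fun_sum; apply: eq_bigr => i _; rewrite linear_funZ. Qed.

End LinearFunctions.

Section TensorLift.
Variable k : fieldType.
Implicit Types U V : vectType k.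

Lemma tensor_lift_linear U V (W : lmodType k) (f : U -> V -> W) :
  linear (tensor_lift f).
Proof.
move=> a s t; rewrite /tensor_lift scaler_sumr -big_split; apply: eq_bigr => i _.
rewrite scaler_sumr -big_split; apply: eq_bigr => j _.
by rewrite !mxE scalerDl scalerA.
Qed.

HB.instance Definition _ U V (W : lmodType k) (f : U -> V -> W) :=
  GRing.isLinear.Build k (tensor U V) W _ (tensor_lift f)
    (tensor_lift_linear f).

Lemma eq_tensor_lift U V (W : lmodType k) (f g : U -> V -> W) :
  f =2 g -> tensor_lift f =1 tensor_lift g.
Proof.
by move=> fg t; apply: eq_bigr => i _; apply: eq_bigr => j _; rewrite fg.
Qed.

Lemma tensor_lift_pure U V (W : lmodType k) (f : U -> V -> W) u v :
  bilinear_map f -> tensor_lift f (pure u v) = f u v.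
Proof.
case=> fl fr; rewrite [in RHS](coord_vbasis (memvf u)) (linear_sumZ (fl v)).
apply: eq_bigr => i _.
rewrite [in RHS](coord_vbasis (memvf v)) (linear_sumZ (fr _)) scaler_sumr.
by apply: eq_bigr => j _; rewrite mxE scalerA.
Qed.

Lemma pure_bilinear U V : bilinear_map (@pure k U V).
Proof.
split=> [v a u u'|u a v v']; apply/matrixP=> i j; rewrite !mxE linearD linearZ /=.
  by rewrite mulrDl mulrA.
by rewrite mulrDr mulrCA.
Qed.

Lemma linear_tensor_lift U V (W W' : lmodType k) (f : U -> V -> W)
    (g : W -> W') :
  linear g -> forall t, g (tensor_lift f t) = tensor_lift (fun u v => g (f u v)) t.
Proof.
move=> g_lin t; rewrite linear_fun_sum //; apply: eq_bigr => i _.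
by rewrite linear_sumZ.
Qed.

End TensorLift.

Arguments linear_tensor_lift {k U V W W' f g} _ t.

Section TensorTheory.
Variable k : fieldType.
Implicit Types U V : vectType k.

Lemma tensor_liftD U V (W : lmodType k) (f g : U -> V -> W) t :
  tensor_lift (fun u v => f u v + g u v) t = tensor_lift f t + tensor_lift g t.
Proof.
rewrite /tensor_lift -big_split; apply: eq_bigr => i _.
by rewrite -big_split; apply: eq_bigr => j _; rewrite scalerDr.
Qed.

Lemma tensor_lift0 U V (W : lmodType k) t :
  tensor_lift (fun (_ : U) (_ : V) => 0 : W) t = 0.
Proof. by rewrite /tensor_lift big1 // => i _; rewrite big1 // => j _; rewrite scaler0. Qed.

Lemma tensor_liftZ U V (W : lmodType k) a (f : U -> V -> W) t :
  tensor_lift (fun u v => a *: f u v) t = a *: tensor_lift f t.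
Proof.
by rewrite -(linear_tensor_lift (g := fun w => a *: w)) // => b u v;
  rewrite scalerDr !scalerA mulrC.
Qed.

Lemma tensor_lift_map U V U' V' (W : lmodType k) (f : U -> U') (g : V -> V')
    (F : U' -> V' -> W) t :
  bilinear_map F ->
  tensor_lift F (tensor_map f g t) = tensor_lift (fun u v => F (f u) (g v)) t.
Proof.
move=> F_bil; rewrite /tensor_map (linear_tensor_lift (tensor_lift_linear F)).
by apply: eq_tensor_lift => u v; apply: tensor_lift_pure.
Qed.

Lemma tensor_lift_mul (A B : falgType k) (W : lmodType k) (F : A -> B -> W) s t :
  bilinear_map F ->
  tensor_lift F (tensor_mul s t) =
  tensor_lift (fun a b => tensor_lift (fun c d => F (a * c) (b * d)) t) s.
Proof.
move=> F_bil; rewrite /tensor_mul (linear_tensor_lift (tensor_lift_linear F)).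
apply: eq_tensor_lift => a b; rewrite (linear_tensor_lift (tensor_lift_linear F)).
by apply: eq_tensor_lift => c d; apply: tensor_lift_pure.
Qed.

Lemma tensor_lift_bilinear U V (T W : lmodType k) (F : T -> U -> V -> W) :
    (forall u v, linear (fun t => F t u v)) ->
  bilinear_map (fun t s => tensor_lift (F t) s).
Proof.
move=> F_lin; split=> [s a t t'|t]; last exact: tensor_lift_linear.
by rewrite -tensor_liftZ -tensor_liftD; apply: eq_tensor_lift => u v; apply: F_lin.
Qed.

Lemma tensor_lift_assoc (U V W : vectType k) (Z : lmodType k) (F : U -> V -> W -> Z) t :
    (forall v w, linear (fun u => F u v w)) ->
    (forall u w, linear (fun v => F u v w)) ->
    (forall u v, linear (fun w => F u v w)) ->
  tensor_lift (fun u => tensor_lift (F u)) (tensor_assoc t) =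
  tensor_lift (fun s w => tensor_lift (fun u v => F u v w) s) t.
Proof.
move=> F1 F2 F3.
have bil := tensor_lift_bilinear F1.
rewrite /tensor_assoc (linear_tensor_lift (tensor_lift_linear _)).
apply: eq_tensor_lift => s w; rewrite (linear_tensor_lift (tensor_lift_linear _)).
apply: eq_tensor_lift => u v; rewrite tensor_lift_pure // tensor_lift_pure //.
Qed.

(* [id = \sum_t b_t (x) l_t] is all that is needed: no independence. *)
Lemma endo_trace_dual V (I : finType) (b : I -> V) (l : I -> V -> k)
    (f : V -> V) :
    (forall t, linear (l t : V -> k^o)) -> linear f ->
    (forall h, h = \sum_t l t h *: b t) ->
  endo_trace f = \sum_t l t (f (b t)).
Proof.
move=> l_lin f_lin dec; pose X := vbasis {:V}.
transitivity (\sum_(i < \dim {:V}) \sum_t l t X`_i * coord X i (f (b t))).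
  apply: eq_bigr => i _; rewrite mxE {1}(dec X`_i).
  rewrite (linear_sumZ f_lin) linear_sum; apply: eq_bigr => t _.
  by rewrite linearZ.
rewrite exchange_big; apply: eq_bigr => t _.
rewrite [f (b t) in RHS](coord_vbasis (memvf _)).
rewrite (linear_sumZ (l_lin t)); apply: eq_bigr => i _.
exact: mulrC.
Qed.

End TensorTheory.

(** * Products with grouplike and skew-primitive elements: coproduct, counit, antipode *)

Section HopfTheory.
Variables (k : fieldType) (H : hopfAlgType k).
Implicit Types h x y z : H.

Lemma mulr_bilinear (A : algType k) : bilinear_map (fun u v : A => u * v).
Proof.
split=> [v a u u'|u a v v'] /=; first by rewrite mulrDl -scalerAl.
by rewrite mulrDr -scalerAr.
Qed.

(** Coproducts are met only under [tensor_lift] of a bilinear map, so the multiplicativity of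
    [comul] is restated in that form. *)
Lemma tensor_lift_grouplike (W : lmodType k) (F : H -> H -> W) z h :
  bilinear_map F -> comul H z = pure z z ->
  tensor_lift F (comul H (z * h)) =
  tensor_lift (fun u v => F (z * u) (z * v)) (comul H h).
Proof.
move=> F_bil Dz; rewrite comulM tensor_lift_mul // Dz tensor_lift_pure //.
have [Fl Fr] := F_bil; split=> [v a u u'|u a v v'].
  rewrite -tensor_liftZ -tensor_liftD; apply: eq_tensor_lift => c d.
  by rewrite mulrDl -scalerAl Fl.
rewrite -tensor_liftZ -tensor_liftD; apply: eq_tensor_lift => c d.
by rewrite mulrDl -scalerAl Fr.
Qed.

Lemma tensor_lift_skew_primitive (W : lmodType k) (F : H -> H -> W) x z h :
  bilinear_map F -> comul H x = pure x 1 + pure z x ->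
  tensor_lift F (comul H (x * h)) =
  tensor_lift (fun u v => F (x * u) v + F (z * u) (x * v)) (comul H h).
Proof.
move=> F_bil Dx; rewrite comulM tensor_lift_mul // Dx linearD /=.
have [Fl Fr] := F_bil.
rewrite !tensor_lift_pure; first by rewrite -tensor_liftD; apply: eq_tensor_lift => u v; rewrite mul1r.
all: split=> [v a u u'|u a v v']; rewrite -tensor_liftZ -tensor_liftD;
  apply: eq_tensor_lift => c d; rewrite mulrDl -scalerAl ?Fl ?Fr //.
Qed.

Lemma counit_grouplike z : z \is a GRing.unit -> comul H z = pure z z ->
  counit H z = 1.
Proof.
move=> Uz Dz; have := counitl z; rewrite Dz tensor_lift_pure => [eq_z|].
  have /eqP := congr1 (fun h => h * z^-1) eq_z.
  rewrite -scalerAl divrr // -subr_eq0 -[X in _ - X]scale1r -scalerBl.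
  by rewrite scaler_eq0 oner_eq0 orbF subr_eq0 => /eqP.
split=> [v a u u'|u a v v']; last by rewrite scalerDr !scalerA mulrC.
by rewrite linearD linearZ /= scalerDl scalerA.
Qed.

Lemma counit_skew_primitive x z : z \is a GRing.unit -> comul H z = pure z z ->
  comul H x = pure x 1 + pure z x -> counit H x = 0.
Proof.
move=> Uz Dz Dx; have := counitl x; rewrite Dx linearD /= !tensor_lift_pure.
- rewrite (counit_grouplike Uz Dz) scale1r => /eqP; rewrite -subr_eq0 addrK.
  by rewrite scaler_eq0 oner_eq0 orbF => /eqP.
all: split=> [v a u u'|u a v v']; last by rewrite scalerDr !scalerA mulrC.
all: by rewrite linearD linearZ /= scalerDl scalerA.
Qed.

(* [g = g * (id * S) = (g * id) * S] in the convolution algebra. *)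
Lemma convolution_id_injl (g : H -> H) : linear g ->
  (forall h, convolution g idfun h = 0) -> forall h, g h = 0.
Proof.
move=> g_lin g0 h; have /= [mulL mulR] := mulr_bilinear H.
have S_lin a u v : antipode H (a *: u + v) = a *: antipode H u + antipode H v.
  by rewrite linearD linearZ.
pose F (u v w : H) := g u * (v * antipode H w).
have F1 v w : linear (fun u => F u v w) by move=> a u u'; rewrite /F g_lin mulL.
have F2 u w : linear (fun v => F u v w).
  by move=> a v v'; rewrite /F mulL mulR.
have F3 u v : linear (fun w => F u v w).
  by move=> a w w'; rewrite /F S_lin !mulR.
have := congr1 (fun t => tensor_lift (fun u => tensor_lift (F u)) t) (comulA h).
rewrite tensor_lift_assoc // !tensor_lift_map.
- rewrite (eq_tensor_lift (g := fun _ _ => 0)) => [|u v]; last first.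
    rewrite (eq_tensor_lift (g := fun u' v' => g u' * v' * antipode H v)); last first.
      by move=> u' v'; rewrite /F mulrA.
    rewrite -(linear_tensor_lift (g := fun z => z * antipode H v)) //=.
      have := g0 u; rewrite /convolution /= => ->; exact: mul0r.
  rewrite tensor_lift0 => /esym; rewrite /idfun.
  rewrite (eq_tensor_lift (g := fun u v => g (counit H v *: u))).
    by rewrite -(linear_tensor_lift g_lin) counitr.
  move=> u v; rewrite -(linear_tensor_lift (g := fun z => g u * z)) //.
    by rewrite antipoder (linear_funZ g_lin) -scalerAr mulr1.
- exact (tensor_lift_bilinear F1).
- split=> [v a s t|s a v v']; first by rewrite tensor_lift_linear.
  by rewrite -tensor_liftZ -tensor_liftD; apply: eq_tensor_lift => u u'; apply: F3.
Qed.

(** Antimultiplicativity of [S] is not an axiom of the record; only the cases with a generator on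
    the left are derived. The defect [S (z h) z - S h] is killed by convolution with the identity,
    because both of its halves turn into the antipode axiom, at [z h] and at [h], and [z] has counit
    1. *)
Lemma antipode_grouplikeM z h : z \is a GRing.unit -> comul H z = pure z z ->
  antipode H (z * h) = antipode H h * z^-1.
Proof.
move=> Uz Dz; have /= [mulL mulR] := mulr_bilinear H.
pose g h := antipode H (z * h) * z - antipode H h.
suff: g h = 0 by move/eqP; rewrite subr_eq0 => /eqP <-; rewrite mulrK.
apply: convolution_id_injl => [a u v|{}h].
  rewrite /g mulR linearP [antipode H (_ *: _ + _)]linearP mulL.
  by rewrite scalerBr opprD addrACA.
rewrite /convolution (eq_tensor_lift (g := fun u v => antipode H (z * u) * (z * v) + (-1) *: (antipode H u * v))).
  rewrite tensor_liftD tensor_liftZ antipodel scaleN1r.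
  rewrite -(tensor_lift_grouplike (F := fun u v => antipode H u * v) _ _ Dz).
    by rewrite antipodel counitM (counit_grouplike Uz Dz) mul1r subrr.
  by split=> [v a u u'|u a v v']; rewrite ?linearD ?linearZ /= ?mulL ?mulR.
by move=> u v; rewrite /g /= mulrBl mulrA scaleN1r.
Qed.

(** Convolving [S (x h) + S (z h) x] with the identity gives the antipode axiom at [x h], which
    vanishes since [x] has counit 0. The grouplike case then rewrites [S (z h)]. *)
Lemma antipode_skew_primitiveM x z h : z \is a GRing.unit ->
  comul H z = pure z z -> comul H x = pure x 1 + pure z x ->
  antipode H (x * h) = - (antipode H h * (z^-1 * x)).
Proof.
move=> Uz Dz Dx; have /= [mulL mulR] := mulr_bilinear H.
pose g h := antipode H (x * h) + antipode H (z * h) * x.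
suff: g h = 0.
  by move/eqP; rewrite /g addr_eq0 => /eqP ->; rewrite antipode_grouplikeM // mulrA.
apply: convolution_id_injl => [a u v|{}h].
  rewrite /g !mulR linearP [antipode H (_ *: _ + _)]linearP mulL.
  by rewrite scalerDr addrACA.
rewrite /convolution (eq_tensor_lift (g := fun u v => antipode H (x * u) * v + antipode H (z * u) * (x * v))).
  rewrite -(tensor_lift_skew_primitive (F := fun u v => antipode H u * v) _ _ Dx).
    by rewrite antipodel counitM (counit_skew_primitive Uz Dz Dx) mul0r scale0r.
  by split=> [v a u u'|u a v v']; rewrite ?linearD ?linearZ /= ?mulL ?mulR.
by move=> u v; rewrite /g /= mulrDl mulrA.
Qed.

Lemma sweedler_power_linear m : linear (@sweedler_power k H m).
Proof.
elim: m => [|m IH] /= a u v.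
  by rewrite linearD linearZ /= scalerDl scalerA.
by rewrite /convolution !linearD !linearZ.
Qed.

Lemma sweedler_convolution_bilinear m :
  bilinear_map (fun u v : H => u * sweedler_power m v).
Proof.
have /= [mulL mulR] := mulr_bilinear H.
by split=> [v a u u'|u a v v']; rewrite ?sweedler_power_linear ?mulL ?mulR.
Qed.

End HopfTheory.

(** * Character sums over linear congruences *)

Section PeriodicSums.
Variables (V : nmodType) (N : nat) (f : nat -> V).
Hypothesis f_per : forall i, f (i + N)%N = f i.

Lemma sum_periodic_shift t : \sum_(i < N) f (i + t)%N = \sum_(i < N) f i.
Proof.
elim: t => [|t <-]; first by apply: eq_bigr => i _; rewrite addn0.
case: N f_per => [|n] per; first by rewrite !big_ord0.
rewrite big_ord_recr big_ord_recl /= addrC; congr (_ + _).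
  by rewrite addnS -addSn addnC per.
by apply: eq_bigr => i _; rewrite /bump /= add1n addSnnS.
Qed.

Lemma sum_periodic_mul j : \sum_(i < j * N) f i = (\sum_(i < N) f i) *+ j.
Proof.
elim: j => [|j IH]; first by rewrite big_ord0 mulr0n.
rewrite mulSn addnC big_split_ord /= IH mulrSr; congr (_ + _).
by rewrite -[RHS](sum_periodic_shift (j * N)); apply: eq_bigr => i _; rewrite addnC.
Qed.

End PeriodicSums.

Lemma prim_root_neq0 (F : fieldType) N (w : F) : N.-primitive_root w -> w != 0.
Proof.
move=> w_prim; apply/eqP => w0; have /eqP := prim_expr_order w_prim.
by rewrite w0 expr0n gtn_eqF ?(prim_order_gt0 w_prim) // eq_sym oner_eq0.
Qed.

Section CongruenceSums.
Variables (k : fieldType) (N n : nat).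
Hypothesis N_gt0 : (0 < N)%N.
Local Notation d := (gcdn N n).

Let d_gt0 : (0 < d)%N. Proof. by rewrite gcdn_gt0 N_gt0. Qed.

Lemma dvdn_periodic c i : (N %| n * (i + N) + c)%N = (N %| n * i + c)%N.
Proof. by rewrite mulnDr addnAC dvdn_addl // dvdn_mull. Qed.

Lemma dvdn_quotient i : (N %| n * i)%N = (N %/ d %| i)%N.
Proof.
have dvN := dvdn_gcdl N n; have dvn := dvdn_gcdr N n.
rewrite -[X in (X %| _)%N](divnK dvN) -[X in (_ %| X * _)%N](divnK dvn) mulnAC.
rewrite dvdn_pmul2r // Gauss_dvdr //.
by rewrite /coprime -(eqn_pmul2r d_gt0) muln_gcdl !divnK // mul1n.
Qed.

Lemma dvdn_gcd_of_congruence i c : (N %| n * i + c)%N -> (d %| c)%N.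
Proof.
move/(dvdn_trans (dvdn_gcdl N n)).
by rewrite dvdn_addr // dvdn_mulr // dvdn_gcdr.
Qed.

Lemma dvdn_quotient_gcd i : (N %| N %/ d * i)%N = (d %| i)%N.
Proof.
have dvN := dvdn_gcdl N n; rewrite -[X in (X %| _)%N](divnK dvN) dvdn_pmul2l //.
by rewrite divn_gt0 // dvdn_leq.
Qed.

(** For [c = e d], Bezout's [u] satisfies [n u = - d] modulo [N]. Shifting [i] by [e u] makes the
    congruence homogeneous, and its solutions are the multiples of [N / d], of which a period
    contains [d]. *)
Lemma count_linear_congruence c :
  \sum_(i < N) (N %| n * i + c)%N%:R = (if (d %| c)%N then d else 0)%:R :> k.
Proof.
case: ifP => [/dvdnP[e ->]|dNc]; last first.
  rewrite big1 // => i _; case: (boolP (N %| _)%N) => // dvN.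
  by rewrite (dvdn_gcd_of_congruence dvN) in dNc.
have [u _ dvu] := Bezoutl n N_gt0.
pose f i : k := (N %| n * i + e * d)%N%:R.
have f_per i : f (i + N)%N = f i by rewrite /f dvdn_periodic.
rewrite -(sum_periodic_shift f_per (e * u)).
transitivity (\sum_(i < (d * (N %/ d))%N) (N %/ d %| i)%N%:R : k).
  rewrite [(d * _)%N]mulnC divnK ?dvdn_gcdl //; apply: eq_bigr => i _; congr (_%:R).
  rewrite /f mulnDr -addnA dvdn_addl ?dvdn_quotient //.
  by rewrite mulnCA -mulnDr dvdn_mull // addnC mulnC.
rewrite (sum_periodic_mul (f := fun i => (N %/ d %| i)%N%:R)); last first.
  by move=> i; rewrite dvdn_addl.
suff -> : \sum_(i < (N %/ d)%N) (N %/ d %| i)%N%:R = 1 :> k by [].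
have: (0 < N %/ d)%N by rewrite divn_gt0 // dvdn_leq // dvdn_gcdl.
case: (N %/ d)%N => // m _; rewrite big_ord_recl dvdn0 big1 ?addr0 // => i _.
by rewrite gtnNdvd // /bump leq0n /= add1n ltnS ltn_ord.
Qed.

Variables (w : k).
Hypothesis (w_prim : N.-primitive_root w) (N_odd : odd N).

Let w_neq0 := prim_root_neq0 w_prim.

Let G (D D' i : nat) : k :=
  w ^+ (i * D) * w^-1 ^+ (i * D') * (N %| n * i + (D + D'))%N%:R.

Lemma twisted_congruence_periodic D D' i : G D D' (i + N) = G D D' i.
Proof.
rewrite /G dvdn_periodic !mulnDl !exprD ![w ^+ (N * _)]exprM ![w^-1 ^+ (N * _)]exprM.
by rewrite [w^-1 ^+ N]exprVn (prim_expr_order w_prim) invr1 !expr1n !mulr1.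
Qed.

(** Shifting [i] by [N / d] preserves the congruence and multiplies the summand by
    [w ^ (N / d * (D - D'))], so a nonzero sum forces [d] to divide [D - D']. Solvability of the
    congruence makes [d] divide [D + D'], hence [2 D']; as [d] is odd it divides [D']. This is where
    the parity of [N] enters. *)
Lemma twisted_congruence_eq0 D D' : ~~ (d %| D')%N -> \sum_(i < N) G D D' i = 0.
Proof.
move=> dND'; case: (boolP (d %| D + D')%N) => [dvDD|dNDD]; last first.
  rewrite big1 // => i _; rewrite /G; case: (boolP (N %| _)%N) => [dvN|]; last by rewrite mulr0.
  by rewrite (dvdn_gcd_of_congruence dvN) in dNDD.
set e := (N %/ d)%N; pose z := w ^+ (e * D) * w^-1 ^+ (e * D').
have shift i : G D D' (i + e) = z * G D D' i.
  rewrite /G !mulnDl !exprD [RHS]mulrA; congr (_ * _%:R).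
    by rewrite mulrACA mulrC.
  by rewrite mulnDr addnAC dvdn_addl // dvdn_quotient.
have /eqP : \sum_(i < N) G D D' i = z * \sum_(i < N) G D D' i.
  rewrite mulr_sumr -{1}(sum_periodic_shift (twisted_congruence_periodic D D') e).
  by apply: eq_bigr => i _; rewrite shift.
rewrite -subr_eq0 -{1}[\sum_(i < N) _]mul1r -mulrBl mulf_eq0 subr_eq0.
case/orP => [/eqP z1|/eqP //]; case/negP: dND'.
have d_odd : odd d by apply: dvdn_odd N_odd; apply: dvdn_gcdl.
rewrite -(Gauss_dvdr (n := 2)) ?coprimen2 //.
rewrite -dvdn_quotient_gcd -/e mul2n -addnn.
rewrite (prim_order_dvd w_prim) mulnDr exprD.
have {1}-> : w ^+ (e * D') = w ^+ (e * D).
  by rewrite -[LHS]mul1r z1 /z mulrAC exprVn mulfK // expf_neq0.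
by rewrite -exprD -mulnDr -(prim_order_dvd w_prim) dvdn_quotient_gcd.
Qed.

(** For each solution [j] of the second congruence, the substitution of [i + j] for [i] in the
    coupled sum turns its congruence into the first one and its summand into the product of the two.
    Each such [j] thus contributes one full coupled sum. There are [d] of them or none, and in the
    latter case the coupled sum vanishes too. *)
Lemma twisted_congruence_prod D D' :
  (\sum_(i < N) w ^+ (i * D) * (N %| n * i + D)%N%:R) *
  (\sum_(i < N) w^-1 ^+ (i * D') * (N %| n * i + D')%N%:R) =
  d%:R * \sum_(i < N) G D D' i.
Proof.
have expw1 a b c : (N %| n * a + b)%N -> w ^+ (c * b) * w ^+ (c * (n * a)) = 1.
  by move=> dv; apply/eqP; rewrite -exprD -mulnDr addnC -(prim_order_dvd w_prim) dvdn_mull.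
transitivity (\sum_(j < N) (N %| n * j + D')%N%:R * \sum_(i < N) G D D' i).
  rewrite mulrC mulr_suml; apply: eq_bigr => j _.
  rewrite -(sum_periodic_shift (twisted_congruence_periodic D D') j).
  rewrite !mulr_sumr; apply: eq_bigr => i _.
  case: (boolP (N %| n * j + D')%N) => [dvj|]; last by rewrite mulr0 !mul0r.
  rewrite /G mulr1 mul1r mulnDr addnACA (dvdn_addl _ dvj).
  case: (boolP (N %| n * i + D)%N) => [dvi|]; last by rewrite !mulr0.
  rewrite !mulr1 !mulnDl !exprD.
  (* Both exponents are congruent to [- n i j], because [D] is congruent to [- n i] and [D'] to
     [- n j]. *)
  have -> : w ^+ (j * D) = w ^+ (i * D').
    apply: (mulIf (expf_neq0 (j * (n * i)) w_neq0)).
    by rewrite expw1 // mulnCA [(j * i)%N]mulnC mulnCA expw1.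
  by rewrite -mulrA [w^-1 ^+ (i * _)]exprVn mulVKf ?expf_neq0 // mulrC.
rewrite -mulr_suml count_linear_congruence; case: ifP => // dND'.
by rewrite twisted_congruence_eq0 ?dND' // !mulr0.
Qed.

(* The congruence couples the two sums on the left; for odd [N] it decouples. *)
Lemma sum_congruence_coupled (A A' : {poly k}) a c :
  (n > 0)%N -> d%:R != 0 :> k ->
  \sum_(i < N) \sum_(D < size A) \sum_(D' < size A') A`_D * A'`_D' *
     (w ^+ (i * (D + a)) * w^-1 ^+ (i * (D' + c)) *
        (N %| n * i + (D + a + (D' + c)))%N%:R) =
  d%:R^-1 *
    ((\sum_(D < size A) A`_D *
       \sum_(i < N) w ^+ (i * (D + a)) * (N %| n * i + (D + a))%N%:R) *
     (\sum_(D < size A') A'`_D *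
       \sum_(i < N) w^-1 ^+ (i * (D + c)) * (N %| n * i + (D + c))%N%:R)).
Proof.
move=> n_gt0 dk_neq0; apply: canRL (mulKf dk_neq0) _.
transitivity (\sum_(D < size A) \sum_(D' < size A') A`_D * A'`_D' *
    (d%:R * \sum_(i < N) G (D + a) (D' + c) i)).
  rewrite exchange_big mulr_sumr; apply: eq_bigr => D _.
  rewrite exchange_big mulr_sumr; apply: eq_bigr => D' _.
  by rewrite mulrCA; congr (_ * _); rewrite -mulr_sumr.
rewrite mulr_suml; apply: eq_bigr => D _; set s := A`_D * _.
rewrite mulr_sumr; apply: eq_bigr => D' _; rewrite /s.
by rewrite [RHS]mulrACA twisted_congruence_prod.
Qed.

End CongruenceSums.

(** * Cyclotomic conjugation *)

Section IntegerPolynomialsAtRootsOfUnity.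
Variables (k : closedFieldType) (char0 : [pchar k] =i pred0).
Local Notation ev p z := (map_poly (intr : int -> k) p).[z].

Lemma natr_char0_neq0 m : (0 < m)%N -> m%:R != 0 :> k.
Proof. by move=> m_gt0; rewrite (iffLR (pcharf0P k) char0) -lt0n. Qed.

Lemma intr_char0_eq0 (c : int) : c%:~R = 0 :> k -> c = 0.
Proof.
case: c => [[|m]|m] //= /eqP; first by rewrite (negPf (natr_char0_neq0 (ltn0Sn m))).
by rewrite NegzE mulrNz oppr_eq0 (negPf (natr_char0_neq0 (ltn0Sn m))).
Qed.

Lemma prim_root_exists m : (0 < m)%N -> exists z : k, m.-primitive_root z.
Proof.
move=> m_gt0; pose p : {poly k} := 'X^m - 1.
have [r Dp] := closed_field_poly_normal p.
rewrite (monicP _) ?monicXnsubC // scale1r in Dp.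
have rm1: all m.-unity_root r by apply/allP=> z; rewrite -root_prod_XsubC -Dp.
have sz_r: (m < (size r).+1)%N.
  by rewrite -(size_prod_XsubC r id) -Dp size_XnsubC.
have [|z] := hasP (has_prim_root m_gt0 rm1 _ sz_r); last by exists z.
by rewrite -separable_prod_XsubC -Dp separable_Xn_sub_1 // natr_char0_neq0.
Qed.

(** Some factor ['Phi_d] of ['X^m - 1] vanishes at [z]; then [z ^ d = 1], and primitivity leaves
    only [d = m]. *)
Lemma Cyclotomic_prim_root m (z : k) : m.-primitive_root z -> ev 'Phi_m z = 0.
Proof.
move=> z_prim; have m_gt0 := prim_order_gt0 z_prim.
have evXn d : (0 < d)%N -> \prod_(e <- divisors d) ev 'Phi_e z = z ^+ d - 1.
  move=> d_gt0; rewrite -horner_prod -rmorph_prod prod_Cyclotomic //.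
  by rewrite rmorphB rmorph1 /= map_polyXn !hornerE.
have /eqP : \prod_(e <- divisors m) ev 'Phi_e z = 0.
  by rewrite evXn // (prim_expr_order z_prim) subrr.
rewrite prodf_seq_eq0 => /hasP[d]; rewrite -dvdn_divisors //= => dvd_dm /eqP zd0.
have d_gt0 := dvdn_gt0 m_gt0 dvd_dm.
have /eqP : z ^+ d - 1 = 0.
  rewrite -evXn // (big_rem d) /= ?zd0 ?mul0r //.
  by rewrite -dvdn_divisors.
rewrite subr_eq0 -(prim_order_dvd z_prim) => dvd_md.
by have -> : m = d by apply/eqP; rewrite eqn_dvd dvd_md.
Qed.

(** Suppose the remainder [R] is nonzero. If its resultant with ['Phi_m] is zero, the two have a
    common root in [algC], a primitive root whose minimal polynomial has the degree of ['Phi_m], too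
    large to divide [R]. If not, the resultant is a nonzero integer in the ideal of two polynomials
    that vanish at [z], which characteristic zero forbids. *)
Lemma Cyclotomic_dvd (P : {poly int}) m (z : k) :
  m.-primitive_root z -> ev P z = 0 -> Pdiv.Ring.rmodp P 'Phi_m = 0.
Proof.
move=> z_prim Pz0; have m_gt0 := prim_order_gt0 z_prim.
have Phi_monic := Cyclotomic_monic m.
set R := Pdiv.Ring.rmodp P _; apply/eqP/idPn => R_neq0.
have szR : (size R < size 'Phi_m)%N by rewrite Pdiv.Ring.ltn_rmodpN0 ?monic_neq0.
have Rz0 : ev R z = 0.
  move: Pz0; rewrite {1}(Pdiv.RingMonic.rdivp_eq Phi_monic P) rmorphD rmorphM /=.
  by rewrite hornerD hornerM (Cyclotomic_prim_root z_prim) mulr0 add0r.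
case: (eqVneq (resultant R 'Phi_m) 0) => [/eqP|res_neq0].
  rewrite resultant_eq0; set g := gcdp _ _ => sz_g.
  pose toC := map_poly (intr : int -> algC).
  have toC_inj := map_inj_poly (intr_inj : injective (intr : int -> algC)).
  have sz_toC p : size (toC p) = size p.
    by apply: size_map_inj_poly => //; apply: intr_inj.
  have [x gx0] : exists x, root (toC g) x.
    by apply/closed_rootP; rewrite sz_toC; case: (size g) sz_g => [|[]].
  have root_toC p : g %| p -> root (toC p) x.
    case/Pdiv.Idomain.dvdpP=> [[c q] /= c_neq0 Dp].
    have /(congr1 (fun r => (toC r).[x])) := Dp.
    rewrite /toC rmorphM map_polyZ /= hornerM (eqP gx0) mulr0 hornerZ => /eqP.
    by rewrite mulf_eq0 intr_eq0 (negPf c_neq0).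
  have [y y_prim] := C_prim_root_exists m_gt0.
  have x_prim : m.-primitive_root x.
    by rewrite -(root_cyclotomic y_prim) -Cintr_Cyclotomic // root_toC ?dvdp_gcdr.
  have [p [Dp _] min_p] := minCpolyP x.
  have := root_toC R (dvdp_gcdl _ _); rewrite -[toC R]/(map_poly _ _).
  have -> : map_poly intr R = map_poly ratr (map_poly intr R : {poly rat}) :> {poly algC}.
    by rewrite -map_poly_comp; apply: eq_map_poly => c; rewrite /= ratr_int.
  rewrite min_p => /dvdp_leq; rewrite map_poly_eq0_id0 ?intr_eq0 ?lead_coef_eq0 // => /(_ R_neq0).
  rewrite size_map_inj_poly //; last exact: intr_inj.
  rewrite leqNgt -(size_map_poly (ratr : {rmorphism rat -> algC})) -Dp.
  by rewrite (minCpoly_cyclotomic x_prim) -(Cintr_Cyclotomic x_prim) sz_toC szR.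
(* The Bezout form of the resultant is stated for nonconstant polynomials, so a constant remainder
   is excluded directly. *)
have [R_const|R_gt1] := leqP (size R) 1.
  move: Rz0 R_neq0; rewrite (size1_polyC R_const) map_polyC hornerC => /intr_char0_eq0 ->.
  by rewrite eqxx.
have [[u v] /= _ Duv] := resultant_in_ideal R_gt1 (ltn_trans R_gt1 szR).
move/negP: res_neq0; case; apply/eqP/intr_char0_eq0.
rewrite -[LHS](hornerC _ z) -map_polyC /= Duv rmorphD !rmorphM hornerD !hornerM /=.
by rewrite Rz0 (Cyclotomic_prim_root z_prim) !mulr0 addr0.
Qed.

(** [P] is a multiple of ['Phi_m], which also vanishes at [z^-1 = z ^ (m - 1)], again a primitive
    [m]-th root. *)
Lemma intr_poly_root_inv (P : {poly int}) m (z : k) :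
  m.-primitive_root z -> ev P z = 0 -> ev P z^-1 = 0.
Proof.
move=> z_prim Pz0; have m_gt0 := prim_order_gt0 z_prim.
rewrite (Pdiv.RingMonic.rdivp_eq (Cyclotomic_monic m) P).
rewrite (Cyclotomic_dvd z_prim Pz0) addr0 rmorphM hornerM /=.
rewrite (Cyclotomic_prim_root (_ : m.-primitive_root z^-1)) ?mulr0 //.
have <- : z ^+ m.-1 = z^-1.
  apply: (mulfI (prim_root_neq0 z_prim)).
  by rewrite -exprS prednK // (prim_expr_order z_prim) divff ?(prim_root_neq0 z_prim).
by rewrite prim_root_exp_coprime // coprime_sym coprimenP.
Qed.

Lemma root_of_unity_common_order (s : seq (int * k)) :
  (forall p, p \in s -> Defs.root_of_unity p.2) ->
  exists2 m, (0 < m)%N & forall p, p \in s -> p.2 ^+ m = 1.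
Proof.
elim: s => [|p s IH] s_unity; first by exists 1%N.
have [|m m_gt0 sm1] := IH; first by move=> p' sp'; apply: s_unity; rewrite inE sp' orbT.
have [|e e_gt0 pe1] := s_unity p; first by rewrite inE eqxx.
exists (e * m)%N => [|p']; first by rewrite muln_gt0 e_gt0.
rewrite inE => /predU1P[-> | /sm1 p'm1]; first by rewrite exprM pe1 expr1n.
by rewrite mulnC exprM p'm1 expr1n.
Qed.

(** By additivity this is all that uniqueness of the conjugate requires. Once all roots of unity
    involved are powers of one primitive root, the number and its conjugate are the values of one
    integer polynomial at that root and at its inverse. *)
Lemma cyclotomic_conjugate0 (z : k) : cyclotomic_conjugate 0 z -> z = 0.
Proof.
case=> s [s_unity /esym sum0 ->].
have [m m_gt0 sm1] := root_of_unity_common_order s_unity.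
have [x x_prim] := prim_root_exists m_gt0.
(* The fallback exponent 0 is never reached for members of [s]. *)
have [e De] : exists e : int * k -> nat, forall p, p \in s -> p.2 = x ^+ e p.
  pose e (p : int * k) := if [pick i : 'I_m | p.2 == x ^+ i] is Some i then i : nat else 0%N.
  exists e => p /sm1 /(prim_rootP x_prim)[i Di]; rewrite /e.
  by case: pickP => [j /eqP //|/(_ i)]; rewrite Di eqxx.
pose P : {poly int} := \sum_(p <- s) 'X^(e p) *~ p.1.
have evP y : ev P y = \sum_(p <- s) y ^+ e p *~ p.1.
  rewrite rmorph_sum horner_sum; apply: eq_bigr => p _.
  by rewrite rmorphMz /= map_polyXn -scaler_int hornerZ hornerXn mulrzl.
have: ev P x^-1 = 0.
  apply: intr_poly_root_inv x_prim _; rewrite evP; apply: etrans sum0.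
  by apply: eq_big_seq => p /De <-.
rewrite evP => sum0'; apply: etrans sum0'.
by apply: eq_big_seq => p /De ->; rewrite exprVn.
Qed.
End IntegerPolynomialsAtRootsOfUnity.

Section CyclotomicConjugate.
Variable k : fieldType.
Implicit Types z t : k.
Local Notation conj := (@cyclotomic_conjugate k).

Lemma cyclotomic_conjugate_root w : Defs.root_of_unity w -> conj w w^-1.
Proof.
move=> w_unity; exists [:: (1, w)]; split; rewrite ?big_seq1 //.
by move=> p; rewrite inE => /eqP ->.
Qed.

Lemma cyclotomic_conjugate_zero : conj 0 0.
Proof. by exists [::]; split; rewrite ?big_nil. Qed.

Lemma cyclotomic_conjugateD z z' t t' : conj z z' -> conj t t' -> conj (z + t) (z' + t').
Proof.
move=> [s [s_unity -> ->]] [r [r_unity -> ->]].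
exists (s ++ r); split; rewrite ?big_cat // => p; rewrite mem_cat.
by case/orP; [apply: s_unity | apply: r_unity].
Qed.

Lemma cyclotomic_conjugateN z z' : conj z z' -> conj (- z) (- z').
Proof.
move=> [s [s_unity -> ->]]; exists [seq (- p.1, p.2) | p <- s]; split.
- by move=> _ /mapP[p sp ->] /=; apply: (s_unity p).
- by rewrite big_map -sumrN; apply: eq_bigr => p _; rewrite mulrNz.
- by rewrite big_map -sumrN; apply: eq_bigr => p _; rewrite mulrNz.
Qed.

Lemma root_of_unityM w v : Defs.root_of_unity w -> Defs.root_of_unity v -> @Defs.root_of_unity k (w * v).
Proof.
move=> [m m_gt0 wm1] [e e_gt0 ve1]; exists (m * e)%N; first by rewrite muln_gt0 m_gt0.
by rewrite exprMn exprM wm1 expr1n mulnC exprM ve1 expr1n mulr1.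
Qed.

Lemma cyclotomic_conjugateM z z' t t' : conj z z' -> conj t t' -> conj (z * t) (z' * t').
Proof.
move=> [s [s_unity -> ->]] [r [r_unity -> ->]].
exists [seq (p.1 * p'.1, p.2 * p'.2) | p <- s, p' <- r]; split.
- by move=> _ /allpairsP[[p p'] /= [sp rp' ->]]; apply: root_of_unityM; auto.
- rewrite big_allpairs_dep mulr_suml; apply: eq_bigr => p _.
  rewrite mulr_sumr; apply: eq_bigr => p' _ /=.
  by rewrite mulrzAl mulrzAr mulrzA_C mulrzA.
- rewrite big_allpairs_dep mulr_suml; apply: eq_bigr => p _.
  rewrite mulr_sumr; apply: eq_bigr => p' _ /=.
  by rewrite mulrzAl mulrzAr invfM mulrzA_C mulrzA.
Qed.

Lemma cyclotomic_conjugate_one : conj 1 1.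
Proof. by rewrite -{2}invr1; apply: cyclotomic_conjugate_root; exists 1%N. Qed.

Lemma cyclotomic_conjugateX z z' n : conj z z' -> conj (z ^+ n) (z' ^+ n).
Proof.
move=> zz'; elim: n => [|n IH]; first exact: cyclotomic_conjugate_one.
by rewrite !exprS; apply: cyclotomic_conjugateM.
Qed.

Lemma cyclotomic_conjugate_bool (b : bool) : conj b%:R b%:R.
Proof.
by case: b; [apply: cyclotomic_conjugate_one | apply: cyclotomic_conjugate_zero].
Qed.

Lemma cyclotomic_conjugate_sum (I : Type) (r : seq I) (P : pred I) (f g : I -> k) :
  (forall i, conj (f i) (g i)) ->
  conj (\sum_(i <- r | P i) f i) (\sum_(i <- r | P i) g i).
Proof.
move=> fg; apply: (big_ind2 conj) => [||i _]; last exact: fg.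
  exact: cyclotomic_conjugate_zero.
by move=> *; apply: cyclotomic_conjugateD.
Qed.

End CyclotomicConjugate.

Lemma cyc_conjE (k : closedFieldType) (z z' : k) : [pchar k] =i pred0 ->
  cyclotomic_conjugate z z' -> cyc_conj z = z'.
Proof.
move=> char0 zz'; rewrite /cyc_conj; case: classical_sets.xgetP => [t _ zt | /(_ z') //].
apply/eqP; rewrite -subr_eq0; apply/eqP/(cyclotomic_conjugate0 char0).
by rewrite -(subrr z); apply: cyclotomic_conjugateD zt (cyclotomic_conjugateN zz').
Qed.

(** The Gaussian binomial coefficient, given by a Pascal rule: the quotient of q-factorials would be
    meaningless at a root of unity. *)
Fixpoint qbinom (k : pzRingType) (w : k) (a r : nat) : k :=
  match a, r with
  | _, 0 => 1
  | 0, _.+1 => 0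
  | a'.+1, r'.+1 => w ^+ r'.+1 * qbinom w a' r'.+1 + qbinom w a' r'
  end.

(* In a Taft algebra the m-th Sweedler power of x^a g^i is
   x^a \sum_D (sweedler_poly w m a)`_D w^(i D) g^(m i + D). *)
Fixpoint sweedler_poly (k : fieldType) (w : k) (m a : nat) : {poly k} :=
  if m is m'.+1 then
    \sum_(r < a.+1) (qbinom w a r * w ^+ (r * r)) *: ('X^r * sweedler_poly w m' r)
  else (a == 0)%:R%:P.

(* The trace of S o P^(n-1) on the span of the x^a g^i, i < N, in the Taft
   algebra of parameter w. *)
Definition taft_term (k : fieldType) (w : k) (N n a : nat) : k :=
  (-1) ^+ a * w ^+ 'C(a, 2) *
  \sum_(D < size (sweedler_poly w n.-1 a)) (sweedler_poly w n.-1 a)`_D *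
    \sum_(i < N) w ^+ (i * (D + a)) * (N %| n * i + (D + a))%N%:R.

(** * Inverting the parameter conjugates the Taft terms *)

Section TaftTermConjugate.
Variables (k : fieldType) (w : k).
Hypothesis w_unity : Defs.root_of_unity w.
Local Notation conj := (@cyclotomic_conjugate k).

Let ww' : conj w w^-1. Proof. exact: cyclotomic_conjugate_root. Qed.

Lemma qbinom_conjugate a r : conj (qbinom w a r) (qbinom w^-1 a r).
Proof.
elim: a r => [|a IH] [|r] /=; try exact: cyclotomic_conjugate_one.
  exact: cyclotomic_conjugate_zero.
by apply: cyclotomic_conjugateD => //; apply: cyclotomic_conjugateM => //; apply: cyclotomic_conjugateX.
Qed.

Lemma sweedler_poly_conjugate m a D :
  conj (sweedler_poly w m a)`_D (sweedler_poly w^-1 m a)`_D.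
Proof.
elim: m a D => [|m IH] a D /=.
  by rewrite !coefC; case: (D == 0)%N; [apply: cyclotomic_conjugate_bool | apply: cyclotomic_conjugate_zero].
rewrite !coef_sum; apply: cyclotomic_conjugate_sum => r.
rewrite !coefZ !coefXnM; apply: cyclotomic_conjugateM.
  by apply: cyclotomic_conjugateM; [apply: qbinom_conjugate | apply: cyclotomic_conjugateX].
by case: ifP => _ //; apply: cyclotomic_conjugate_zero.
Qed.

Lemma sum_coef_widen (p : {poly k}) L (f : nat -> k) : (size p <= L)%N ->
  \sum_(D < size p) p`_D * f D = \sum_(D < L) p`_D * f D.
Proof.
move=> pL; rewrite (big_ord_widen L (fun D => p`_D * f D)) // big_mkcond.
by apply: eq_bigr => D _; case: ltnP => // szD; rewrite nth_default ?mul0r.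
Qed.

Lemma taft_term_conjugate N n a : conj (taft_term w N n a) (taft_term w^-1 N n a).
Proof.
rewrite /taft_term; set p := sweedler_poly w _ _; set p' := sweedler_poly w^-1 _ _.
pose f (v : k) D := \sum_(i < N) v ^+ (i * (D + a)) * (N %| n * i + (D + a))%N%:R.
(* The polynomials for [w] and [w^-1] are not known to have the same size, so both sums are padded
   to a common range. *)
rewrite (sum_coef_widen (f w) (leq_maxl (size p) (size p'))).
rewrite (sum_coef_widen (f w^-1) (leq_maxr (size p) (size p'))).
apply: cyclotomic_conjugateM; [apply: cyclotomic_conjugateM|].
- by apply/cyclotomic_conjugateX/cyclotomic_conjugateN/cyclotomic_conjugate_one.
- exact: cyclotomic_conjugateX.
apply: cyclotomic_conjugate_sum => D; apply: cyclotomic_conjugateM.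
  exact: sweedler_poly_conjugate.
apply: cyclotomic_conjugate_sum => i; apply: cyclotomic_conjugateM.
  exact: cyclotomic_conjugateX.
exact: cyclotomic_conjugate_bool.
Qed.

End TaftTermConjugate.

(** * Normal forms modulo lower degree *)

(** What becomes of a polynomial in [z] when it is moved to the right past some [v] with
    [z v = c v z]. *)
Notation dilate c g := (g \Po (c *: 'X)).

Section PolynomialDilation.
Variable R : comNzRingType.
Implicit Types (c e : R) (g : {poly R}).

Lemma dilate_dilate c e g : dilate c (dilate e g) = dilate (e * c) g.
Proof. by rewrite -comp_polyA comp_polyZ comp_polyX scalerA. Qed.

Lemma dilateXn c n : dilate c 'X^n = c ^+ n *: 'X^n.
Proof. by rewrite comp_Xn_poly exprZn. Qed.

End PolynomialDilation.

Section SkewCommutation.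
Variables (k : fieldType) (A : algType k).
Implicit Types (z v : A) (c : k) (g : {poly k}).

Lemma horner_algZ z c g : horner_alg z (c *: g) = c *: horner_alg z g.
Proof. by rewrite linearZ /= mulr_algl. Qed.

Lemma horner_algM z f g : horner_alg z (f * g) = horner_alg z f * horner_alg z g.
Proof. exact: rmorphM. Qed.

Lemma horner_algXn z n : horner_alg z 'X^n = z ^+ n.
Proof. by rewrite rmorphXn /= horner_algX. Qed.

Lemma horner_alg_coef z g : horner_alg z g = \sum_(j < size g) g`_j *: z ^+ j.
Proof.
rewrite -{1}[g]coefK poly_def linear_sum /=; apply: eq_bigr => j _.
by rewrite horner_algZ horner_algXn.
Qed.

Lemma horner_alg_skewC z v c g :
  z * v = c *: (v * z) -> horner_alg z g * v = v * horner_alg z (dilate c g).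
Proof.
move=> zv; elim/poly_ind: g => [|g b IH].
  by rewrite comp_poly0 !linear0 mul0r mulr0.
rewrite comp_polyD comp_polyM comp_polyC comp_polyX !rmorphD !rmorphM /= horner_algZ.
rewrite !horner_algX !horner_algC mulrDl mulrDr; congr (_ + _); last first.
  by rewrite -scalerAl -scalerAr mul1r mulr1.
by rewrite -mulrA zv -!scalerAr [in LHS]mulrA IH -!mulrA.
Qed.

Lemma skewCX z v c n : z * v = c *: (v * z) -> z * v ^+ n = c ^+ n *: (v ^+ n * z).
Proof.
move=> zv; elim: n => [|n IH]; first by rewrite !expr0 mulr1 mul1r scale1r.
by rewrite !exprSr mulrA IH -scalerAl -!mulrA zv -scalerAr scalerA.
Qed.

Lemma skewCXl z v c n : z * v = c *: (v * z) -> z ^+ n * v = c ^+ n *: (v * z ^+ n).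
Proof.
move=> zv; elim: n => [|n IH]; first by rewrite !expr0 mulr1 mul1r scale1r.
by rewrite [z ^+ _]exprS [c ^+ _]exprSr -mulrA IH -scalerAr [z * (v * _)]mulrA zv -scalerAl scalerA -mulrA.
Qed.

End SkewCommutation.

Section QuantumPlane.
Variables (k : fieldType) (A : algType k) (w : k) (x y z : A) (s : {poly k}).
Local Notation w' := w^-1.
Hypotheses (zx : z * x = w *: (x * z))
  (zy : z * y = w' *: (y * z)) (yx : y * x = w *: (x * y) + horner_alg z s).
Local Notation "g @z" := (horner_alg z g) (at level 8, format "g @z").

Lemma horner_algMX g a c :
  g@z * (x ^+ a * y ^+ c) = x ^+ a * y ^+ c * (dilate (w ^+ a * w' ^+ c) g)@z.
Proof.
rewrite mulrA (horner_alg_skewC _ (skewCX a zx)) -!mulrA.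
by rewrite (horner_alg_skewC _ (skewCX c zy)) dilate_dilate.
Qed.

(* [lower d]: the span of the [x^a y^c z^i] with [a + c < d]. *)
Inductive lower : nat -> A -> Prop :=
| lower0 d : lower d 0
| lower_cons d a c g h : (a + c < d)%N -> lower d h ->
    lower d (x ^+ a * y ^+ c * g@z + h).

Lemma lower_mon d a c g : (a + c < d)%N -> lower d (x ^+ a * y ^+ c * g@z).
Proof. by move=> acd; rewrite -[_ * _]addr0; apply: lower_cons => //; apply: lower0. Qed.

Lemma lowerD d h h' : lower d h -> lower d h' -> lower d (h + h').
Proof.
elim=> {d h} [d|d a c g h acd _ IH] h'd; first by rewrite add0r.
by rewrite -addrA; apply: lower_cons => //; apply: IH.
Qed.

Lemma lowerZ d b h : lower d h -> lower d (b *: h).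
Proof.
elim=> {d h} [d|d a c g h acd _ IH]; first by rewrite scaler0; apply: lower0.
by rewrite scalerDr scalerAr -horner_algZ; apply: lower_cons.
Qed.

Lemma lower_le d e h : (d <= e)%N -> lower d h -> lower e h.
Proof.
move=> de dh; elim: dh de => {d h} [d|d a c g h acd _ IH] de; first exact: lower0.
by apply: lower_cons; [apply: leq_trans de | apply: IH].
Qed.

Lemma lower_horner d g h : lower d h -> lower d (g@z * h).
Proof.
elim=> {d h} [d|d a c g' h acd _ IH]; first by rewrite mulr0; apply: lower0.
rewrite mulrDr mulrA horner_algMX -(mulrA (_ * y ^+ c)) -horner_algM.
exact: lower_cons.
Qed.

Lemma lower_xl d h : lower d h -> lower d.+1 (x * h).
Proof.
elim=> {d h} [d|d a c g' h acd _ IH]; first by rewrite mulr0; apply: lower0.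
by rewrite mulrDr !mulrA -exprS; apply: lower_cons.
Qed.

(** The shape of the correction [g] is left unspecified: only its loss of one [x] and one [y]
    matters for the filtration. *)
Lemma yx_pow a : exists g,
  y * x ^+ a.+1 = w ^+ a.+1 *: (x ^+ a.+1 * y) + x ^+ a * g@z.
Proof.
elim: a => [|a [g IH]]; first by exists s; rewrite !expr1 expr0 mul1r yx.
(* The first summand is the correction made by the new exchange of [y] and [x], the second is the
   old correction moved past the new [x]. *)
exists (w ^+ a.+1 *: s + dilate w g).
rewrite [x ^+ a.+2 in LHS]exprSr mulrA IH mulrDl -scalerAl -(mulrA _ y x) yx.
rewrite -(mulrA _ _ x) (horner_alg_skewC _ zx) [x ^+ a * _]mulrA -exprSr.
rewrite mulrDr scalerDr -scalerAr scalerA mulrA -!exprSr.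
by rewrite -addrA rmorphD /= horner_algZ mulrDr -scalerAr.
Qed.

Lemma lower_yl d h : lower d h -> lower d.+1 (y * h).
Proof.
elim=> {d h} [d|d a c g' h acd _ IH]; first by rewrite mulr0; apply: lower0.
rewrite mulrDr; apply: lowerD IH; rewrite !mulrA; case: a acd => [|a] acd.
  rewrite expr0 mulr1 -exprS -[_ ^+ _]mul1r -(expr0 x); exact: lower_mon.
have [g ->] := yx_pow a; rewrite !mulrDl -!scalerAl; apply: lowerD.
  apply: lowerZ; rewrite -[x ^+ _ * y * _]mulrA -exprS.
  by apply: lower_mon; rewrite addnS ltnS.
rewrite -[_ * _ * y ^+ c]mulrA (horner_alg_skewC _ (skewCX c zy)) mulrA.
rewrite -mulrA -horner_algM; apply: lower_mon; rewrite ltnS ltnW //.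
by apply: leq_trans acd; rewrite addSn.
Qed.

Lemma lower_monM d a c g h :
  lower d h -> lower (a + c + d) (x ^+ a * y ^+ c * g@z * h).
Proof.
move=> /(lower_horner g); rewrite -!mulrA; move: (g@z * h) => {}h dh.
elim: a => [|a IH]; last by rewrite exprS -mulrA addSn; apply: lower_xl.
rewrite expr0 mul1r add0n; elim: c => [|c IH]; first by rewrite expr0 mul1r.
by rewrite exprS -mulrA addSn; apply: lower_yl.
Qed.

(** The bound in [lower] is strict: [lower e.+1] means degree at most [e], which added to a degree
    below [d] stays below [d + e]. *)
Lemma lowerM d e h h' : lower d h -> lower e.+1 h' -> lower (d + e) (h * h').
Proof.
move=> dh eh'; elim: dh => {d h} [d|d a c g h acd _ IH].
  by rewrite mul0r; apply: lower0.
rewrite mulrDl; apply: lowerD => //; apply: lower_le (lower_monM _ _ _ eh').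
by rewrite addnS -addSn leq_add2r.
Qed.

(** Each of the [c * a] exchanges of a [y] with an [x] costs a factor [w], up to terms that have
    lost both letters. *)
Lemma lower_yx a c :
  lower (a + c) (y ^+ c * x ^+ a - w ^+ (c * a) *: (x ^+ a * y ^+ c)).
Proof.
case: a => [|a].
  by rewrite muln0 expr0 mulr1 mul1r scale1r subrr; apply: lower0.
elim: c => [|c IH].
  by rewrite mul0n !expr0 mulr1 mul1r scale1r subrr; apply: lower0.
have -> : y ^+ c.+1 * x ^+ a.+1 - w ^+ (c.+1 * a.+1) *: (x ^+ a.+1 * y ^+ c.+1) =
  y * (y ^+ c * x ^+ a.+1 - w ^+ (c * a.+1) *: (x ^+ a.+1 * y ^+ c)) +
  w ^+ (c * a.+1) *: (y * x ^+ a.+1 * y ^+ c - w ^+ a.+1 *: (x ^+ a.+1 * y ^+ c.+1)).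
  rewrite mulrBr scalerBr !mulrA -exprS scalerA -exprD -mulSnr -scalerAr !mulrA.
  by rewrite addrA subrK.
apply: lowerD; first by rewrite addnS; apply: lower_yl.
apply: lowerZ; have [g ->] := yx_pow a; rewrite mulrDl -scalerAl -(mulrA _ y) -exprS.
rewrite addrAC subrr add0r -(mulrA _ g@z) (horner_alg_skewC _ (skewCX c zy)) mulrA.
by apply: lower_mon; rewrite addSn addnS ltnW.
Qed.

(** The principal symbol of [h]. It asserts that the whole component of degree [a + c] sits at
    [(a, c)], so other monomials of the same total degree are excluded as well. *)
Definition leads a c g h := lower (a + c) (h - x ^+ a * y ^+ c * g@z).

Lemma leads_mon a c g : leads a c g (x ^+ a * y ^+ c * g@z).
Proof. by rewrite /leads subrr; apply: lower0. Qed.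

Lemma leads_lower a c g h : leads a c g h -> lower (a + c).+1 h.
Proof.
move=> gh; rewrite -(subrK (x ^+ a * y ^+ c * g@z) h); apply: lowerD.
  exact: lower_le gh.
exact: lower_mon.
Qed.

Lemma leads_add_lower a c g h h' : leads a c g h -> lower (a + c) h' -> leads a c g (h + h').
Proof. by move=> gh ?; rewrite /leads addrAC; apply: lowerD. Qed.

Lemma leadsZ a c b g h : leads a c g h -> leads a c (b *: g) (b *: h).
Proof. by move=> gh; rewrite /leads horner_algZ -scalerAr -scalerBr; apply: lowerZ. Qed.

Lemma leads_sum (I : Type) (r : seq I) (P : pred I) a c (g : I -> {poly k}) h :
  (forall i, P i -> leads a c (g i) (h i)) ->
  leads a c (\sum_(i <- r | P i) g i) (\sum_(i <- r | P i) h i).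
Proof.
move=> gh; rewrite /leads linear_sum mulr_sumr -sumrB.
by elim/big_rec: _ => [|i t /gh]; [apply: lower0 | apply: lowerD].
Qed.

(** The dilation comes from moving [g(z)] past [x^a' y^c'], and the power of [w] from moving [y^c]
    past [x^a']. *)
Lemma leadsM a c g h a' c' g' h' : leads a c g h -> leads a' c' g' h' ->
  leads (a + a') (c + c')
    (w ^+ (c * a') *: (dilate (w ^+ a' * w' ^+ c') g * g')) (h * h').
Proof.
move=> gh gh'; set m := x ^+ a * y ^+ c * g@z.
pose m' := x ^+ a' * y ^+ c' * g'@z.
have -> : h * h' = m * m' + ((h - m) * h' + m * (h' - m')).
  by rewrite mulrBl mulrBr [_ + (m * h' - _)]addrA subrK [RHS]addrC subrK.
apply: leads_add_lower; last first.
  rewrite addnACA; apply: lowerD; first exact: lowerM gh (leads_lower gh').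
  exact: lower_monM.
set G := dilate _ g * g'; set W := w ^+ _; pose Y := y ^+ c' * G@z.
have -> : m * m' = x ^+ a * (y ^+ c * x ^+ a' * Y).
  rewrite /m -mulrA /m' (mulrA g@z) horner_algMX -(mulrA _ _ g'@z) -horner_algM.
  by rewrite !mulrA.
have lead_eq : x ^+ (a + a') * y ^+ (c + c') * (W *: G)@z =
    x ^+ a * ((W *: (x ^+ a' * y ^+ c)) * Y).
  rewrite horner_algZ -scalerAr -scalerAl -scalerAr !exprD; congr (_ *: _).
  by rewrite !mulrA.
rewrite /leads lead_eq -mulrBr -mulrBl.
have lowerY : lower c'.+1 Y.
  by rewrite /Y -[y ^+ c']mul1r -(expr0 x); apply: lower_mon.
have := lower_monM a 0 1 (lowerM (lower_yx a' c) lowerY).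
by rewrite expr0 rmorph1 !mulr1 addn0 !addnA.
Qed.

End QuantumPlane.

(** * Indicators of quantum planes *)

Lemma qbinom_small (R : pzRingType) (w : R) a r : (a < r)%N -> qbinom w a r = 0.
Proof.
elim: a r => [|a IH] [|r] //= ar.
by rewrite !IH ?mulr0 ?addr0 // ltnW.
Qed.

Lemma sum_qbinomS (k : fieldType) (W : lmodType k) (w : k) a (T : nat -> W) :
  \sum_(r < a.+1) qbinom w a r *: (w ^+ r *: T r + T r.+1) =
  \sum_(r < a.+2) qbinom w a.+1 r *: T r.
Proof.
transitivity (\sum_(r < a.+1) qbinom w a r *: T r.+1 +
    (T 0 + \sum_(r < a.+1) (w ^+ r.+1 * qbinom w a r.+1) *: T r.+1)).
  under eq_bigr do rewrite scalerDr.
  rewrite big_split /= addrC; congr (_ + _).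
  rewrite big_ord_recl [in RHS]big_ord_recr /= (qbinom_small w (ltnSn a)) mulr0 scale0r addr0.
  rewrite expr0 scale1r; congr (_ + _); first by case: (a); rewrite /= scale1r.
  by apply: eq_bigr => r _; rewrite scalerA mulrC.
rewrite addrCA -big_split [RHS]big_ord_recl /= scale1r; congr (_ + _).
by apply: eq_bigr => r _; rewrite addrC -scalerDl.
Qed.

Section SkewPrimitivePowers.
Variables (k : fieldType) (H : hopfAlgType k).
Implicit Types x z h : H.

Lemma bilinear_mapM (W : lmodType k) (F : H -> H -> W) x z :
  bilinear_map F -> bilinear_map (fun u v => F (x * u) (z * v)).
Proof.
by case=> Fl Fr; split=> [v a u u'|u a v v'] /=; rewrite mulrDr -scalerAr ?Fl ?Fr.
Qed.

Lemma tensor_lift_grouplikeX (W : lmodType k) (F : H -> H -> W) z i :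
  bilinear_map F -> comul H z = pure z z ->
  tensor_lift F (comul H (z ^+ i)) = F (z ^+ i) (z ^+ i).
Proof.
move=> F_bil Dz; elim: i F F_bil => [|i IH] F F_bil.
  by rewrite expr0 comul1 tensor_lift_pure.
rewrite exprS tensor_lift_grouplike // (IH (fun u v => F (z * u) (z * v))) //.
exact: bilinear_mapM.
Qed.

(** The q-binomial theorem for the coproduct of [x^a]: the summands of the coproduct of [x] satisfy
    [(z (x) x) (x (x) 1) = c (x (x) 1) (z (x) x)]. *)
Lemma tensor_lift_skew_primitiveX (W : lmodType k) (F : H -> H -> W) x z c a h :
    bilinear_map F -> comul H z = pure z z -> comul H x = pure x 1 + pure z x ->
    z * x = c *: (x * z) ->
  tensor_lift F (comul H (x ^+ a * h)) =
  \sum_(r < a.+1) qbinom c a r *: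
    tensor_lift (fun u v => F (x ^+ (a - r) * z ^+ r * u) (x ^+ r * v)) (comul H h).
Proof.
move=> F_bil Dz Dx zx; elim: a h => [|a IH] h.
  rewrite big_ord1 /= scale1r expr0 mul1r; apply: eq_tensor_lift => u v.
  by rewrite !mul1r.
pose T r := tensor_lift (fun u v => F (x ^+ (a.+1 - r) * z ^+ r * u) (x ^+ r * v)) (comul H h).
rewrite -(sum_qbinomS c a T) exprSr -mulrA IH; apply: eq_bigr => r _.
congr (_ *: _); rewrite (tensor_lift_skew_primitive _ _ Dx); last exact: bilinear_mapM.
rewrite tensor_liftD -tensor_liftZ; congr (_ + _); apply: eq_tensor_lift => u v.
  rewrite -[in LHS](mulrA _ _ (x * u)) (mulrA _ x) (skewCXl _ zx) -!scalerAl -scalerAr.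
  rewrite (linear_funZ (F_bil.1 _)) !mulrA -exprSr subSn //.
  by rewrite -ltnS.
by rewrite subSS !exprSr !mulrA.
Qed.

End SkewPrimitivePowers.

Section QuantumPlaneIndicator.
Variables (k : fieldType) (H : hopfAlgType k) (w : k) (N : nat).
Variables (x y z : H) (s : {poly k}).
Local Notation w' := w^-1.
Hypotheses (N_gt0 : (0 < N)%N) (wN : w ^+ N = 1) (zN : z ^+ N = 1).
Hypotheses (zx : z * x = w *: (x * z)) (zy : z * y = w' *: (y * z))
  (yx : y * x = w *: (x * y) + horner_alg z s).
Hypotheses (Dz : comul H z = pure z z) (Dx : comul H x = pure x 1 + pure z x)
  (Dy : comul H y = pure y 1 + pure z y).
Local Notation "g @z" := (horner_alg z g) (at level 8, format "g @z").
Local Notation S := (antipode H).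
Local Notation leads := (@leads k H x y z).
Local Notation lower := (@lower k H x y z).

Let w_neq0 : w != 0.
Proof.
apply/eqP => w0; have /eqP := wN.
by rewrite w0 expr0n gtn_eqF // eq_sym oner_eq0.
Qed.

Let zV : z * z ^+ N.-1 = 1. Proof. by rewrite -exprS prednK. Qed.
Let Vz : z ^+ N.-1 * z = 1. Proof. by rewrite -exprSr prednK. Qed.

Let z_unit : z \is a GRing.unit.
Proof. by apply/unitrP; exists (z ^+ N.-1). Qed.

Let z_inv : z^-1 = z ^+ N.-1.
Proof. by apply: (mulrI z_unit); rewrite divrr // zV. Qed.

Lemma leads_x a g : leads a 0 g (x ^+ a * g@z).
Proof. by have := leads_mon x y z a 0 g; rewrite expr0 mulr1. Qed.

Lemma leads_y c g : leads 0 c g (y ^+ c * g@z).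
Proof. by have := leads_mon x y z 0 c g; rewrite expr0 mul1r. Qed.

Lemma counit_monomial a c i :
  counit H (x ^+ a * y ^+ c * z ^+ i) = ((a == 0) && (c == 0))%N%:R.
Proof.
have counitX h n : counit H (h ^+ n) = (counit H h : k) ^+ n.
  by elim: n => [|n IH]; rewrite ?counit1 // !exprS counitM IH.
rewrite !counitM !counitX (counit_grouplike z_unit Dz) expr1n mulr1.
rewrite (counit_skew_primitive z_unit Dz Dx) (counit_skew_primitive z_unit Dz Dy).
by rewrite !expr0n -natrM mulnb.
Qed.

Lemma sweedler_power_monomial m a c i :
  sweedler_power m.+1 (x ^+ a * y ^+ c * z ^+ i) =
  \sum_(r < a.+1) \sum_(r' < c.+1) (qbinom w a r * qbinom w' c r') *:
    (x ^+ (a - r) * z ^+ r * (y ^+ (c - r') * z ^+ (r' + i)) *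
       sweedler_power m (x ^+ r * y ^+ r' * z ^+ i)).
Proof.
have F_bil := sweedler_convolution_bilinear H m.
rewrite [LHS]/= /convolution /= -mulrA.
rewrite (tensor_lift_skew_primitiveX _ _ F_bil Dz Dx zx); apply: eq_bigr => r _.
have F_bil' := bilinear_mapM (x ^+ (a - r) * z ^+ r) (x ^+ r) F_bil.
rewrite (tensor_lift_skew_primitiveX _ _ F_bil' Dz Dy zy) scaler_sumr.
apply: eq_bigr => r' _; rewrite scalerA; congr (_ *: _).
have F_bil'' := bilinear_mapM (y ^+ (c - r') * z ^+ r') (y ^+ r') F_bil'.
by rewrite (tensor_lift_grouplikeX _ F_bil'' Dz) exprD !mulrA.
Qed.

(** The symbol splits into an [x]-factor and a [y]-factor with inverse parameters, although the two
    letters interact at every step of the recursion: the mixed powers of [w] cancel in pairs. *)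
Lemma leads_sweedler_power m a c i :
  leads a c ('X^(m * i) * dilate (w ^+ i) (sweedler_poly w m a) *
             dilate (w' ^+ i) (sweedler_poly w' m c))
    (sweedler_power m (x ^+ a * y ^+ c * z ^+ i)).
Proof.
elim: m a c => [|m IH] a c.
  rewrite /= counit_monomial mul1r !comp_polyC -polyCM -natrM mulnb.
  rewrite /leads horner_algC; case: andP => [[/eqP -> /eqP ->]|_].
    by rewrite !expr0 !mul1r subrr; apply: lower0.
  by rewrite scale0r mulr0 subrr; apply: lower0.
rewrite sweedler_power_monomial /=.
set G := (X in leads a c X _).
suff -> : G = \sum_(r < a.+1) \sum_(r' < c.+1) (qbinom w a r * qbinom w' c r') *:
    (w ^+ ((c - r') * r) *: (dilate (w ^+ r * w' ^+ r')
       (w ^+ (0 * 0) *: (dilate (w ^+ 0 * w' ^+ (c - r')) 'X^r * 'X^(r' + i))) *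
       ('X^(m * i) * dilate (w ^+ i) (sweedler_poly w m r) *
             dilate (w' ^+ i) (sweedler_poly w' m r')))).
  apply: leads_sum => r _; apply: leads_sum => r' _; apply: leadsZ.
  have := leadsM zx zy yx (leadsM zx zy yx (leads_x (a - r) 'X^r)
    (leads_y (c - r') 'X^(r' + i))) (IH r r').
  by rewrite addn0 add0n !subnK ?horner_algXn // -ltnS.
rewrite /G mulSn [in LHS]raddf_sum [in LHS]raddf_sum /=.
rewrite -(mulrA 'X^(i + m * i)) mulr_suml mulr_sumr; apply: eq_bigr => r _.
rewrite !mulr_sumr; apply: eq_bigr => r' _.
rewrite !comp_polyZ !comp_polyM !dilateXn comp_polyZ dilateXn.
move: (dilate _ _) (dilate _ _) => P Q.
rewrite -!(scalerAl, scalerAr) !scalerA; congr (_ *: _); last first.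
  by rewrite !exprD; ring.
have wK n : w ^+ n * w' ^+ n = 1 by rewrite -exprMn divff ?expr1n.
rewrite mul0n !expr0 !mul1r !exprMn -!exprM !mulnDr !exprD [(r' * r)%N]mulnC.
(* Moving [y^(c - r')] past [x^r] undoes the factor from moving [z^r] past [y^(c - r')]; moving
   [z^r'] past [x^r] undoes that of [z^r] past [y^r']. The surviving [w^(r r)] and [w^-(r' r')] are
   those of [sweedler_poly]. *)
rewrite [(i * r)%N]mulnC [(i * r')%N]mulnC.
ring: (wK ((c - r') * r)%N) (wK (r * r')%N).
Qed.

(** * The antipode on leading terms *)

Lemma antipode_one : S 1 = 1.
Proof.
have /= [mulL mulR] := mulr_bilinear H.
have := antipodel (1 : H); rewrite comul1 tensor_lift_pure => [|].
  by rewrite mulr1 counit1 scale1r.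
by split=> [v a u u'|u a v v'] /=; rewrite ?linearP ?mulL ?mulR.
Qed.

Lemma antipode_skewX v a h : comul H v = pure v 1 + pure z v ->
  S (v ^+ a * h) = S h * (- (z^-1 * v)) ^+ a.
Proof.
move=> Dv; elim: a h => [|a IH] h; first by rewrite !expr0 mul1r mulr1.
rewrite exprSr -mulrA IH (antipode_skew_primitiveM _ z_unit Dz Dv) exprS.
by rewrite -mulrN mulrA.
Qed.

(** Writing [z^-1] as [z^(N - 1)] keeps everything polynomial in [z]. The factor [h] carries the
    induction, since the antipode rules peel generators off the left. *)
Lemma antipode_horner g h : S (g@z * h) = S h * (g \Po 'X^(N.-1))@z.
Proof.
elim/poly_ind: g h => [|g b IH] h.
  by rewrite comp_poly0 !linear0 mul0r mulr0 linear0.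
rewrite comp_polyD comp_polyM comp_polyC comp_polyX !rmorphD /= !horner_algM.
rewrite !horner_algC horner_algX mulrDl mulrDr linearD /=; congr (_ + _); last first.
  by rewrite -scalerAl mul1r linearZ /= -scalerAr mulr1.
rewrite -mulrA IH (antipode_grouplikeM _ z_unit Dz) z_inv -horner_algXn -mulrA.
by rewrite -!horner_algM mulrC.
Qed.

Let wVN : w ^+ N.-1 = w'.
Proof. by apply: (mulfI w_neq0); rewrite -exprS prednK // wN divff. Qed.

Let w'VN : w' ^+ N.-1 = w.
Proof. by rewrite exprVn wVN invrK. Qed.

Lemma antipode_skew_horner v c : z * v = c *: (v * z) ->
  - (z^-1 * v) = v * (- c ^+ N.-1 *: 'X^(N.-1))@z.
Proof.
by move=> zv; rewrite z_inv (skewCXl _ zv) horner_algZ horner_algXn -scalerAr scaleNr.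
Qed.

(** The exponent is [1 + 2 + ... + a]: the [j]-th factor contributes [w^-1] of its own and
    [w^-(j - 1)] for moving the accumulated powers of [z^-1] past its [x]. *)
Lemma leads_antipode_x a :
  leads a 0 (((-1) ^+ a * w' ^+ 'C(a.+1, 2)) *: 'X^(N.-1 * a)) ((- (z^-1 * x)) ^+ a).
Proof.
elim: a => [|a IH].
  by have := leads_x 0 1; rewrite rmorph1 mulr1 muln0 !expr0 mul1r scale1r.
have := leads_x 1 (- w ^+ N.-1 *: 'X^(N.-1)); rewrite expr1 -(antipode_skew_horner zx).
move/(leadsM zx zy yx IH); rewrite addn1 -exprSr.
rewrite comp_polyZ dilateXn expr0 expr1 mulr1 mul0n scale1r -!(scalerAl, scalerAr) !scalerA.
rewrite -exprD mulnS addnC wVN; congr (leads _ _ (_ *: _) _).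
rewrite exprM wVN [in RHS]binS bin1 exprD ![_ ^+ a.+1]exprSr; ring.
Qed.

Lemma leads_antipode_y c :
  leads 0 c (((-1) ^+ c * w ^+ 'C(c.+1, 2)) *: 'X^(N.-1 * c)) ((- (z^-1 * y)) ^+ c).
Proof.
elim: c => [|c IH].
  by have := leads_y 0 1; rewrite rmorph1 mulr1 muln0 !expr0 mul1r scale1r.
have := leads_y 1 (- w' ^+ N.-1 *: 'X^(N.-1)); rewrite expr1 -(antipode_skew_horner zy).
move/(leadsM zx zy yx IH); rewrite addn1 -exprSr.
rewrite comp_polyZ dilateXn expr0 expr1 mul1r muln0 scale1r -!(scalerAl, scalerAr) !scalerA.
rewrite -exprD mulnS addnC w'VN; congr (leads _ _ (_ *: _) _).
rewrite exprM w'VN [in RHS]binS bin1 exprD ![_ ^+ c.+1]exprSr; ring.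
Qed.

(** The symbol of [g(z^-1) (- z^-1 y)^c (- z^-1 x)^a] brought to normal order. The two mixed
    factors, from [y^c] and from [z^-c] moved past [x^a], cancel. *)
Definition antipode_poly a c (g : {poly k}) : {poly k} :=
  ((-1) ^+ (a + c) * w' ^+ 'C(a.+1, 2) * w ^+ 'C(c.+1, 2)) *:
    ('X^(N.-1 * (a + c)) * (g \Po ((w' ^+ a * w ^+ c) *: 'X^(N.-1)))).

Lemma leads_antipode_monomial a c g :
  leads a c (antipode_poly a c g) (S (x ^+ a * y ^+ c * g@z)).
Proof.
rewrite -mulrA (antipode_skewX _ _ Dx) (antipode_skewX _ _ Dy).
rewrite -[g@z]mulr1 antipode_horner antipode_one mul1r.
have := leads_x 0 (g \Po 'X^(N.-1)); rewrite expr0 mul1r.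
move/(leadsM zx zy yx)/(_ (leads_antipode_y c))/(leadsM zx zy yx)/(_ (leads_antipode_x a)).
rewrite !add0n !addn0 mul0n !expr0 scale1r mul1r mulr1.
set Q := (X in leads _ _ X _ -> _); suff -> : antipode_poly a c g = Q by [].
rewrite /Q comp_polyM comp_polyZ dilateXn -!(scalerAl, scalerAr) !scalerA.
rewrite /antipode_poly dilate_dilate -!comp_polyA comp_Xn_poly exprZn.
have -> : (w' ^+ c * w ^+ a) ^+ N.-1 = w' ^+ a * w ^+ c.
  by rewrite exprMn -!exprM ![(_ * N.-1)%N]mulnC !exprM wVN w'VN mulrC.
rewrite mulnDr !exprD; congr (_ *: _); last by ring.
have wK n : w ^+ n * w' ^+ n = 1 by rewrite -exprMn divff ?expr1n.
have -> : w ^+ a ^+ (N.-1 * c) = w' ^+ (c * a).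
  by rewrite -exprM mulnCA exprM wVN mulnC.
by ring: (wK (c * a)%N).
Qed.

Lemma lower_antipode d h : lower d h -> lower d (S h).
Proof.
elim=> {d h} [d|d a c g h acd _ IH]; first by rewrite linear0; apply: lower0.
rewrite linearD; apply: lowerD IH.
exact: lower_le acd (leads_lower (leads_antipode_monomial a c g)).
Qed.

Lemma leads_antipode a c g h : leads a c g h -> leads a c (antipode_poly a c g) (S h).
Proof.
move=> gh; rewrite -(subrK (x ^+ a * y ^+ c * g@z) h) addrC linearD.
apply: leads_add_lower (leads_antipode_monomial a c g) _.
exact: lower_antipode.
Qed.

(** * The trace in PBW coordinates *)

Variables (M : nat) (l : 'I_N -> 'I_M -> 'I_N -> H -> k).
Hypotheses (l_linear : forall a c i, linear (l a c i : H -> k^o))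
  (l_mon : forall (a : 'I_N) (c : 'I_M) (i : 'I_N) a' c' i',
    l a c i (x ^+ a' * y ^+ c' * z ^+ i') =
    [&& a' == a, c' == c & i' %% N == i]%N%:R)
  (l_dec : forall h, h = \sum_(t : 'I_N * 'I_M * 'I_N)
    l t.1.1 t.1.2 t.2 h *: (x ^+ t.1.1 * y ^+ t.1.2 * z ^+ t.2)).

Lemma coord_lower (a : 'I_N) (c : 'I_M) (i : 'I_N) h : lower (a + c) h -> l a c i h = 0.
Proof.
move: {-2}(a + c)%N (leqnn (a + c)%N) => d le_d dh; elim: dh le_d => {d h}.
  by move=> d _; apply: (linear_fun0 (l_linear a c i)).
move=> d a' c' g h lt_d _ IH le_d.
rewrite (linear_funD (l_linear a c i)) IH // addr0 horner_alg_coef mulr_sumr.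
under eq_bigr do rewrite -scalerAr.
rewrite (linear_sumZ (l_linear a c i)) big1 // => j _; rewrite l_mon.
case: and3P => [[/eqP a'a /eqP c'c _]|_]; last exact: mulr0.
by rewrite a'a c'c ltnNge le_d in lt_d.
Qed.

Lemma coord_leads (a : 'I_N) (c : 'I_M) (i : 'I_N) g h : leads a c g h ->
  l a c i h = l a c i (x ^+ a * y ^+ c * g@z).
Proof.
move=> gh; rewrite -[h in LHS](subrK (x ^+ a * y ^+ c * g@z)).
by rewrite (linear_funD (l_linear a c i)) coord_lower ?add0r.
Qed.

Lemma mod_predn_mul i e : (i < N)%N -> (N.-1 * e %% N == i)%N = (N %| i + e)%N.
Proof.
move=> iN; rewrite -{1}(modn_small iN) -(eqn_modDr e) -[X in (_ + X)%N]mul1n -mulnDl.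
by rewrite addn1 prednK // modnMr eq_sym.
Qed.

Lemma square_bin2 a : (a * a = 'C(a, 2) + 'C(a.+1, 2))%N.
Proof.
elim: a => // a IH; have := binS a 1; have := binS a.+1 1.
by rewrite !bin1 !mulSn !mulnS IH => -> ->; lia.
Qed.

(** The image carries [z] to the power [- (a + c + m i + D + D')], and asking that this be [i]
    modulo [N] gives the congruence. On its solutions [th ^ (m i + D + D')] equals
    [th ^ - (i + a + c)]; its squares [w^(a a)] and [w^-(c c)] combine with the triangular powers of
    [antipode_poly] into ['C(a, 2)] and ['C(c, 2)]. *)
Lemma coord_antipode_sweedler m (a : 'I_N) (c : 'I_M) (i : 'I_N) :
  let A := sweedler_poly w m a in let A' := sweedler_poly w' m c in
  l a c i (S (sweedler_power m (x ^+ a * y ^+ c * z ^+ i))) =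
  ((-1) ^+ a * w ^+ 'C(a, 2)) * ((-1) ^+ c * w' ^+ 'C(c, 2)) *
  \sum_(D < size A) \sum_(D' < size A') A`_D * A'`_D' *
    (w ^+ (i * (D + a)) * w' ^+ (i * (D' + c)) *
       (N %| m.+1 * i + (D + a + (D' + c)))%N%:R).
Proof.
move=> A A'; rewrite (coord_leads _ (leads_antipode (leads_sweedler_power m a c i))).
rewrite -/A -/A' /antipode_poly; set th := w' ^+ a * w ^+ c; set kap := _ * w ^+ 'C(c.+1, 2).
have -> : kap *: ('X^(N.-1 * (a + c)) *
    ('X^(m * i) * dilate (w ^+ i) A * dilate (w' ^+ i) A' \Po th *: 'X^(N.-1))) =
  \sum_(D < size A) \sum_(D' < size A')
    (kap * (A`_D * A'`_D' * (w ^+ i ^+ D * w' ^+ i ^+ D' * th ^+ (m * i + D + D')))) *: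
      'X^(N.-1 * (a + c + (m * i + D + D'))).
  rewrite !comp_polyM -!comp_polyA !comp_polyZ !comp_polyX comp_Xn_poly.
  rewrite !comp_polyE -(mulrA (_ ^+ (m * i))) mulr_suml !mulr_sumr scaler_sumr.
  apply: eq_bigr => D _; rewrite !mulr_sumr scaler_sumr; apply: eq_bigr => D' _.
  rewrite -!(scalerAl, scalerAr) !exprZn -!(scalerAl, scalerAr) !scalerA.
  rewrite -!exprM -!exprD; congr (_ *: 'X^_); last by rewrite !mulnDr !addnA.
  by rewrite !exprD; ring.
pose lX p := l a c i (x ^+ a * y ^+ c * p@z).
have lX_lin : linear (lX : {poly k} -> k^o).
  move=> b p p'; rewrite /lX linearD /= horner_algZ mulrDr -scalerAr.
  by rewrite l_linear.
rewrite -/(lX _) (linear_fun_sum lX_lin) mulr_sumr; apply: eq_bigr => D _.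
rewrite (linear_sumZ lX_lin) mulr_sumr; apply: eq_bigr => D' _.
rewrite /lX horner_algXn l_mon !eqxx /= mod_predn_mul //.
have -> : (i + (a + c + (m * i + D + D')) = m.+1 * i + (D + a + (D' + c)))%N by lia.
case: (boolP (N %| _)%N) => [dvN|]; last by rewrite scaler0 !mulr0.
rewrite [_ *: _]mulr1 mulr1 [RHS]mulrCA [LHS]mulrCA; congr (_ * _).
have thN : th ^+ N = 1.
  by rewrite /th exprMn -!exprM ![(_ * N)%N]mulnC !exprM exprVn wN invr1 !expr1n mulr1.
have th_neq0 : th != 0 by rewrite mulf_neq0 ?expf_neq0 ?invr_eq0.
(* Multiplying by this power completes the exponent of [th] to a multiple of [N], so no inverse of
   [th] need be expanded. *)
apply: (mulIf (expf_neq0 (i + a + c) th_neq0)).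
have th1 : th ^+ (m * i + D + D') * th ^+ (i + a + c) = 1.
  case/dvdnP: dvN => e De; rewrite -exprD.
  have -> : (m * i + D + D' + (i + a + c) = N * e)%N by rewrite [(N * e)%N]mulnC -De; lia.
  by rewrite exprM thN expr1n.
have thE : th ^+ (i + a + c) = w' ^+ (i * a) * w' ^+ (a * a) * w' ^+ (a * c) *
    (w ^+ (i * c) * w ^+ (a * c) * w ^+ (c * c)).
  rewrite /th exprMn -!exprM -!exprD; congr (_ ^+ _ * _ ^+ _); lia.
rewrite -!mulrA th1 {}thE {th1 th_neq0 thN lX_lin lX} /kap !square_bin2 exprD.
rewrite -!exprM !mulnDr !exprD.
have wK n : w ^+ n * w' ^+ n = 1 by rewrite -exprMn divff ?expr1n.
ring: (wK (i * a)%N) (wK (i * c)%N) (wK (a * c)%N) (wK 'C(a, 2)) (wK 'C(c, 2)).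
Qed.

Lemma indicator_quantum_plane n : odd N -> N.-primitive_root w -> (0 < n)%N ->
  (gcdn N n)%:R != 0 :> k ->
  indicator H n = (gcdn N n)%:R^-1 *
    ((\sum_(a < N) taft_term w N n a) * (\sum_(c < M) taft_term w' N n c)).
Proof.
move=> N_odd w_prim n_gt0 d_neq0; pose f h := S (sweedler_power n.-1 h).
have f_lin : linear f by move=> b u v; rewrite /f sweedler_power_linear linearP.
rewrite /indicator (endo_trace_dual (f := f) (fun t => l_linear t.1.1 t.1.2 t.2) f_lin l_dec).
rewrite -(pair_bigA _ (fun t i => l t.1 t.2 i (f (x ^+ t.1 * y ^+ t.2 * z ^+ i)))) /=.
rewrite -(pair_bigA _ (fun a c => \sum_i l a c i (f (x ^+ a * y ^+ c * z ^+ i)))) /=.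
rewrite mulr_suml mulr_sumr; apply: eq_bigr => a _.
rewrite !mulr_sumr; apply: eq_bigr => c _.
under eq_bigr do rewrite /f coord_antipode_sweedler prednK //.
rewrite -mulr_sumr (sum_congruence_coupled N_gt0 w_prim N_odd) //.
by rewrite /taft_term mulrCA [in RHS]mulrACA.
Qed.

End QuantumPlaneIndicator.

(** * The regular representation *)

Section EndomorphismAlgebra.
Variables (k : fieldType) (V : vectType k) (V_proper : (0 < dim V)%N).

Let end_lalgMixin := GRing.Lmodule_isLalgebra.Build k
  (lfun_comp_nzRingType V_proper) (fun a f g => comp_lfunZl a f g).
Let end_lalgType : lalgType k :=
  HB.pack 'End(V) (lfun_comp_nzRingType V_proper) end_lalgMixin.
Let end_algMixin := GRing.Lalgebra_isAlgebra.Build k end_lalgType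
  (fun a f g => comp_lfunZr a f g).

(* Unlike [lfun_algType], the product is composition, not its opposite. *)
Definition end_algType : algType k := HB.pack 'End(V) end_lalgType end_algMixin.

Lemma end_mulE (f g : end_algType) v :
  (f * g : 'End(V)) v = (f : 'End(V)) ((g : 'End(V)) v).
Proof. exact: comp_lfunE. Qed.

End EndomorphismAlgebra.

(** The corrections add up to geometric sums in [w^-1] and [w], both multiplied by [al]. At
    [n + 1 = M] the conditions on [al] kill them, so that [y^M] commutes with [x] up to a scalar. *)
Lemma expr_yx (k : fieldType) (A : algType k) (w al : k) (x y z : A) n :
    w != 0 -> z * y = w^-1 *: (y * z) -> y * x = w *: (x * y) + al *: (z ^+ 2 - 1) ->
  y ^+ n.+1 * x = w ^+ n.+1 *: (x * y ^+ n.+1) +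
    al *: (y ^+ n * ((\sum_(j < n.+1) w^-1 ^+ j) *: z ^+ 2 - (\sum_(j < n.+1) w ^+ j)%:A)).
Proof.
move=> w_neq0 zy yx; elim: n => [|n IH].
  by rewrite !big_ord1 !expr0 !scale1r !mul1r !expr1.
have step : w ^+ n.+1 *: ((z ^+ 2 - 1) * y ^+ n.+1) +
    y ^+ n.+1 * ((\sum_(j < n.+1) w^-1 ^+ j) *: z ^+ 2 - (\sum_(j < n.+1) w ^+ j)%:A) =
    y ^+ n.+1 * ((\sum_(j < n.+2) w^-1 ^+ j) *: z ^+ 2 - (\sum_(j < n.+2) w ^+ j)%:A).
  rewrite mulrBl mul1r (skewCXl 2 (skewCX n.+1 zy)).
  rewrite [\sum_(j < n.+2) w ^+ j]big_ord_recr [\sum_(j < n.+2) w^-1 ^+ j]big_ord_recr /=.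
  rewrite !mulrBr -!scalerAr !mulr1 scalerBr scalerA addrACA -opprD -!scalerDl.
  congr (_ *: _ - _ *: _); last exact: addrC.
  by rewrite addrC exprVn expr2 mulVKf ?expf_neq0.
rewrite exprS -mulrA IH mulrDr -!scalerAr !mulrA yx mulrDl -!scalerAl -exprS.
rewrite scalerDr scalerA -exprSr -addrA -(mulrA x) -exprS; congr (_ + _).
by rewrite scalerA mulrC -scalerA -scalerDr step.
Qed.

(* [V] has the basis [e a c i], [a < N], [c < M], [i < N], extended to all
   indices as the PBW monomials [x^a y^c z^i] are. *)
Section QuantumPlaneRepresentation.
Variables (k : fieldType) (N M : nat) (w al : k).
Local Notation w' := w^-1.
Hypothesis (N_gt0 : (0 < N)%N) (wN : w ^+ N = 1).
Hypotheses (al_N : al * \sum_(j < N) w ^+ j = 0) (al_M : al * \sum_(j < M) w ^+ j = 0)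
  (al_M' : al * \sum_(j < M) w' ^+ j = 0).
Variables (V : vectType k) (V_proper : (0 < dim V)%N) (e : nat -> nat -> nat -> V).
Hypotheses (e_out : forall a c i, (N <= a)%N || (M <= c)%N -> e a c i = 0)
  (e_mod : forall a c i j, i = j %[mod N] -> e a c i = e a c j)
  (op_exists : forall f : nat -> nat -> nat -> V,
    (forall a c i, (N <= a)%N || (M <= c)%N -> f a c i = 0) ->
    (forall a c i j, i = j %[mod N] -> f a c i = f a c j) ->
    exists g : 'End(V), forall a c i, g (e a c i) = f a c i)
  (op_ext : forall f g : 'End(V), (forall a c i, f (e a c i) = g (e a c i)) -> f = g).
Local Notation A := (end_algType V_proper).

(** These make explicit the correction [y x^a = w^a x^a y + al x^(a-1) (u_a z^2 - v_a)]: in [u_a],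
    moving [z^2] past the remaining [x]'s turns the sum into [w^(a-1) v_a]. *)
Let v_ n : k := \sum_(j < n) w ^+ j.
Let u_ n : k := w ^+ n * w' * v_ n.

Let w_neq0 : w != 0.
Proof.
apply/eqP => w0; have /eqP := wN.
by rewrite w0 expr0n gtn_eqF // eq_sym oner_eq0.
Qed.

Let v_S n : v_ n.+1 = 1 + w * v_ n.
Proof.
rewrite /v_ big_ord_recl expr0 mulr_sumr; congr (_ + _).
by apply: eq_bigr => i _; rewrite exprS.
Qed.

Let v_Sr n : v_ n.+1 = v_ n + w ^+ n.
Proof. by rewrite /v_ big_ord_recr. Qed.

Let u_S n : u_ n.+1 = w * u_ n + w ^+ n * w ^+ n.
Proof.
have ww' : w * w' = 1 by rewrite divff.
by rewrite /u_ v_Sr exprS; ring: ww'.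
Qed.

Let u_0 : u_ 0 = 0. Proof. by rewrite /u_ /v_ big_ord0 mulr0. Qed.
Let v_0 : v_ 0 = 0. Proof. by rewrite /v_ big_ord0. Qed.

Let addS_mod i j : i = j %[mod N] -> i.+1 = j.+1 %[mod N].
Proof. by move=> ij; rewrite -addn1 -(addn1 j) -modnDml ij modnDml. Qed.

(** The operators are forced: they are left multiplication by [x], [y], [z] on PBW monomials. The
    content is that they respect truncation and satisfy the relations. *)
Lemma quantum_plane_representation : exists X Y Z : A,
  [/\ [/\ X ^+ N = 0, Y ^+ M = 0 & Z ^+ N = 1],
      [/\ Z * X = w *: (X * Z), Z * Y = w' *: (Y * Z) &
          Y * X = w *: (X * Y) + al *: (Z ^+ 2 - 1)] &
      forall a c i, (X ^+ a * Y ^+ c * Z ^+ i : 'End(V)) (e 0 0 0) = e a c i].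
Proof.
have lfunZ (f : 'End(V)) b v : f (b *: v) = b *: f v by rewrite linearZ.
have lfunD (f : 'End(V)) u v : f (u + v) = f u + f v by rewrite linearD.
have lfunB (f : 'End(V)) u v : f (u - v) = f u - f v by rewrite linearB.
have [X Xe] : exists X : A, forall a c i, (X : 'End(V)) (e a c i) = e a.+1 c i.
  apply: op_exists => [a c i out | a c i j ij]; last exact: e_mod.
  by apply: e_out; case/orP: out => [/leqW -> //|->]; rewrite orbT.
have [Z Ze] : exists Z : A, forall a c i,
    (Z : 'End(V)) (e a c i) = (w ^+ a * w' ^+ c) *: e a c i.+1.
  apply: op_exists => [a c i out | a c i j ij].
    by rewrite e_out ?scaler0.
  by congr (_ *: _); apply/e_mod/addS_mod.
have [Y Ye] : exists Y : A, forall a c i, (Y : 'End(V)) (e a c i) =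
    w ^+ a *: e a c.+1 i +
    al *: ((u_ a * w' ^+ c * w' ^+ c) *: e a.-1 c i.+2 - v_ a *: e a.-1 c i).
  apply: op_exists => [a c i out | a c i j ij]; last first.
    by congr (_ *: _ + _ *: (_ *: _ - _ *: _)); apply: e_mod => //; do 2!apply: addS_mod.
  rewrite (@e_out a c.+1) ?scaler0 ?add0r; last by case/orP: out => [->|/leqW ->]; rewrite ?orbT.
  have [Mc|cM] := leqP M c; first by rewrite !(@e_out a.-1) ?Mc ?orbT // !scaler0 subrr scaler0.
  rewrite (leqNgt M) cM orbF in out; case: (ltngtP a N) out => // [aN|->] _.
    have Na : (N <= a.-1)%N by case: (a) aN.
    by rewrite !(@e_out a.-1) ?Na // !scaler0 subrr scaler0.
  (* Only [a = N] is left: the lowered index [N - 1] is in range, so the coefficients themselves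
     must vanish, which is the condition [al_N]. *)
  rewrite scalerBr !scalerA al_N scale0r subr0.
  rewrite (_ : al * _ = 0) ?scale0r //.
  have al_vN : al * v_ N = 0 by [].
  by rewrite /u_; ring: al_vN.
have Xn a a' c i : (X ^+ a' : 'End(V)) (e a c i) = e (a' + a)%N c i.
  elim: a' => [|a' IH]; first by rewrite expr0 id_lfunE.
  by rewrite exprS end_mulE IH Xe.
have Y0 c i : (Y : 'End(V)) (e 0 c i) = e 0 c.+1 i.
  by rewrite Ye u_0 v_0 !mul0r !scale0r subrr scaler0 addr0 scale1r.
have Yn c c' i : (Y ^+ c' : 'End(V)) (e 0 c i) = e 0 (c' + c)%N i.
  elim: c' => [|c' IH]; first by rewrite expr0 id_lfunE.
  by rewrite exprS end_mulE IH Y0.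
have Zn a c i i' : (Z ^+ i' : 'End(V)) (e a c i) = (w ^+ a * w' ^+ c) ^+ i' *: e a c (i' + i)%N.
  elim: i' => [|i' IH]; first by rewrite expr0 id_lfunE scale1r.
  by rewrite exprS end_mulE IH lfunZ Ze scalerA -exprSr.
have ZY : Z * Y = w' *: (Y * Z).
  apply: op_ext => a c i; rewrite scale_lfunE !end_mulE.
  rewrite Ze lfunZ !Ye lfunD !lfunZ lfunB !lfunZ !Ze.
  case: a => [|a].
    rewrite u_0 v_0 !mul0r !scale0r !subrr !scaler0 !addr0 !scalerA exprS.
    by congr (_ *: _); ring.
  rewrite /= !(scalerBr, scalerDr) !scalerA !exprS.
  have ww' : w * w' = 1 by rewrite divff.
  by congr (_ *: _ + (_ *: _ - _ *: _)); ring: ww'.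
have ZX : Z * X = w *: (X * Z).
  apply: op_ext => a c i; rewrite scale_lfunE !end_mulE.
  by rewrite Xe !Ze lfunZ Xe scalerA exprS mulrA.
have YX : Y * X = w *: (X * Y) + al *: (Z ^+ 2 - 1).
  apply: op_ext => a c i; rewrite add_lfunE !scale_lfunE !end_mulE.
  rewrite add_lfunE opp_lfunE Zn id_lfunE Xe !Ye lfunD !lfunZ lfunB !lfunZ !Xe /=.
  (* At [a = 0] the index [a.-1.+1] is 1 rather than 0, harmlessly, since [u_ 0 = v_ 0 = 0]. *)
  have pred_e b j : (u_ a * b) *: e a.-1.+1 c j = (u_ a * b) *: e a c j.
    by case: (a) => //; rewrite u_0 mul0r !scale0r.
  have pred_e' j : v_ a *: e a.-1.+1 c j = v_ a *: e a c j.
    by case: (a) => //; rewrite v_0 !scale0r.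
  rewrite -(mulrA (u_ a)) pred_e pred_e' u_S v_S !(scalerBr, scalerDr) !scalerA add2n exprS.
  rewrite -[RHS]addrA [in RHS]addrACA -opprD -!scalerDl.
  by congr (_ *: _ + (_ *: _ - _ *: _)); rewrite ?exprMn; ring.
have YM : Y ^+ M = 0.
  apply: op_ext => a c i; rewrite zero_lfunE.
  (* This moves [Y ^+ M] past [X ^+ a], down to the vectors with [a = 0], where [Y] only raises
     [c]. *)
  have YMX : Y ^+ M * X = w ^+ M *: (X * Y ^+ M).
    case: M al_M al_M' => [|m] alM alM'; first by rewrite !expr0 mul1r mulr1 scale1r.
    rewrite (expr_yx _ w_neq0 ZY YX) [al *: _]scalerAr scalerBr !scalerA alM alM' !scale0r subrr.
    by rewrite mulr0 addr0.
  have -> : e a c i = (X ^+ a : 'End(V)) (e 0 c i) by rewrite Xn addn0.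
  rewrite -end_mulE (skewCX a YMX) scale_lfunE end_mulE Yn.
  by rewrite e_out ?leq_addr ?orbT // linear0 scaler0.
exists X, Y, Z; split=> [||a c i].
- split=> //.
    apply: op_ext => a c i; rewrite zero_lfunE Xn e_out //.
    by rewrite leq_addr.
  apply: op_ext => a c i; rewrite Zn id_lfunE exprMn -!exprM ![(_ * N)%N]mulnC !exprM.
  rewrite exprVn wN invr1 !expr1n mulr1 scale1r; apply: e_mod.
  by rewrite modnDl.
- by [].
by rewrite !end_mulE Zn !expr0 mulr1 expr1n scale1r Yn Xn !addn0.
Qed.

End QuantumPlaneRepresentation.

(** * PBW coordinates from the universal property *)

Section MonomialBasis.
Variables (k : fieldType) (N M : nat).
Hypotheses (N_gt0 : (0 < N)%N) (M_gt0 : (0 < M)%N).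

Definition monomial_space : vectType k := {ffun 'I_N * 'I_M * 'I_N -> k^o}.
Local Notation V := monomial_space.

Definition monomial_vector (a c i : nat) : V :=
  [ffun t : 'I_N * 'I_M * 'I_N => [&& a == t.1.1, c == t.1.2 & i %% N == t.2]%N%:R : k^o].
Local Notation e := monomial_vector.

Lemma monomial_vector_out a c i : (N <= a)%N || (M <= c)%N -> e a c i = 0.
Proof.
move=> out; apply/ffunP => -[[a' c'] i']; rewrite !ffunE /=.
case: and3P => // -[/eqP Da /eqP Dc _]; move: out.
by rewrite Da Dc (leqNgt N) (leqNgt M) !ltn_ord.
Qed.

Lemma monomial_vector_mod a c i j : i = j %[mod N] -> e a c i = e a c j.
Proof. by move=> ij; apply/ffunP => t; rewrite !ffunE ij. Qed.

Lemma monomial_vector_dec (v : V) : v = \sum_t v t *: e t.1.1 t.1.2 t.2.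
Proof.
apply/ffunP => t; rewrite sum_ffunE (bigD1 t) //= big1 ?addr0 => [|t' t'_neq].
  by rewrite !ffunE !eqxx modn_small // eqxx [_ *: _]mulr1.
rewrite !ffunE; case: and3P => [[/eqP/val_inj a_eq /eqP/val_inj c_eq i_eq]|_].
  case/eqP: t'_neq; move: a_eq c_eq i_eq; case: t t' => [[a c] i] [[a' c'] i'] /= -> ->.
  by rewrite modn_small // => /eqP/val_inj ->.
by rewrite [_ *: _]mulr0.
Qed.

Lemma monomial_space_proper : (0 < dim V)%N.
Proof.
rewrite -dimvf lt0n dimv_eq0; apply/eqP => V0.
have: e 0 0 0 \in (0%VS : {vspace V}) by rewrite -V0 memvf.
rewrite memv0 => /eqP /ffunP /(_ (Ordinal N_gt0, Ordinal M_gt0, Ordinal N_gt0)) /eqP.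
by rewrite !ffunE /= mod0n oner_eq0.
Qed.

Lemma monomial_vector_lift (f : nat -> nat -> nat -> V) :
    (forall a c i, (N <= a)%N || (M <= c)%N -> f a c i = 0) ->
    (forall a c i j, i = j %[mod N] -> f a c i = f a c j) ->
  exists g : 'End(V), forall a c i, g (e a c i) = f a c i.
Proof.
move=> f_out f_mod; pose F (v : V) : V := \sum_t v t *: f t.1.1 t.1.2 t.2.
have F_lin : linear F.
  move=> b u v; rewrite scaler_sumr -big_split; apply: eq_bigr => t _.
  by rewrite !ffunE scalerDl scalerA.
exists (linfun (HB.pack_for {linear V -> V} F (GRing.isLinear.Build k V V _ F F_lin))).
move=> a c i; rewrite lfunE /= /F.
case: (boolP ((N <= a)%N || (M <= c)%N)) => [out|].
  by rewrite (monomial_vector_out _ out) f_out // big1 // => t _; rewrite ffunE scale0r.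
rewrite negb_or -!ltnNge => /andP[aN cM].
have iN : (i %% N < N)%N by rewrite ltn_mod.
rewrite (bigD1 (Ordinal aN, Ordinal cM, Ordinal iN)) //= big1 ?addr0.
  by rewrite ffunE /= !eqxx scale1r; apply: f_mod; rewrite modn_mod.
case=> [[a' c'] i'] t_neq; rewrite ffunE /=.
case: and3P => [[/eqP Da /eqP Dc /eqP Di]|_]; last by rewrite scale0r.
by case/eqP: t_neq; congr (_, _, _); apply: val_inj.
Qed.

Lemma monomial_vector_ext (f g : 'End(V)) :
  (forall a c i, f (e a c i) = g (e a c i)) -> f = g.
Proof.
move=> fg; apply/lfunP => v; rewrite (monomial_vector_dec v) !linear_sum.
by apply: eq_bigr => t _; rewrite !linearZ /= fg.
Qed.

End MonomialBasis.

Section QuantumPlaneCoordinates.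
Variables (k : fieldType) (N M : nat) (w al : k) (H : falgType k) (x y z : H).
Local Notation w' := w^-1.
Hypotheses (N_gt0 : (0 < N)%N) (M_gt0 : (0 < M)%N) (wN : w ^+ N = 1).
Hypotheses (al_N : al * \sum_(j < N) w ^+ j = 0) (al_M : al * \sum_(j < M) w ^+ j = 0)
  (al_M' : al * \sum_(j < M) w' ^+ j = 0).

Definition quantum_plane_relations (A : algType k) (X Y Z : A) : Prop :=
  [/\ X ^+ N = 0, Y ^+ M = 0 & Z ^+ N = 1] /\
  [/\ Z * X = w *: (X * Z), Z * Y = w' *: (Y * Z) &
      Y * X = w *: (X * Y) + al *: (Z ^+ 2 - 1)].

Hypotheses (rels : quantum_plane_relations x y z)
  (univ : forall (A : algType k) (X Y Z : A), quantum_plane_relations X Y Z ->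
     exists phi : {lrmorphism H -> A}, [/\ phi x = X, phi y = Y & phi z = Z])
  (gen : forall W : {vspace H}, 1 \in W ->
     (forall v, v \in W -> [/\ x * v \in W, y * v \in W & z * v \in W]) ->
     forall h, h \in W).

(** The representation sends a monomial to an operator taking [e 0 0 0] to the matching basis
    vector, which gives the dual functionals. Spanning holds because the span contains 1 and is
    stable under left multiplication by the generators. *)
Lemma quantum_plane_coordinates : exists l : 'I_N -> 'I_M -> 'I_N -> H -> k,
  [/\ forall a c i, linear (l a c i : H -> k^o),
      forall (a : 'I_N) (c : 'I_M) (i : 'I_N) a' c' i',
        l a c i (x ^+ a' * y ^+ c' * z ^+ i') =
        [&& a' == a, c' == c & i' %% N == i]%N%:R &
      forall h, h = \sum_(t : 'I_N * 'I_M * 'I_N)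
        l t.1.1 t.1.2 t.2 h *: (x ^+ t.1.1 * y ^+ t.1.2 * z ^+ t.2)].
Proof.
have [[xN yM zN] [zx zy yx]] := rels.
have [X [Y [Z [[XN YM ZN] [ZX ZY YX] Xe]]]] :=
  quantum_plane_representation N_gt0 wN al_N al_M al_M' (monomial_space_proper k N_gt0 M_gt0)
    (@monomial_vector_out k N M) (@monomial_vector_mod k N M)
    (@monomial_vector_lift k N M N_gt0) (@monomial_vector_ext k N M).
have [phi [phix phiy phiz]] := univ (conj (And3 XN YM ZN) (And3 ZX ZY YX)).
pose l a c i h : k := (phi h : 'End(_)) (monomial_vector k N M 0 0 0) (a, c, i).
have l_lin a c i : linear (l a c i : H -> k^o).
  by move=> b u v; rewrite /l linearP add_lfunE scale_lfunE !ffunE.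
have l_mon (a : 'I_N) (c : 'I_M) (i : 'I_N) a' c' i' :
    l a c i (x ^+ a' * y ^+ c' * z ^+ i') = [&& a' == a, c' == c & i' %% N == i]%N%:R.
  by rewrite /l !rmorphM !rmorphXn /= phix phiy phiz Xe ffunE.
exists l; split=> //.
pose mon a c i := x ^+ a * y ^+ c * z ^+ i.
pose P h := \sum_(t : 'I_N * 'I_M * 'I_N) l t.1.1 t.1.2 t.2 h *: mon t.1.1 t.1.2 t.2.
have P_lin : linear P.
  move=> b u v; rewrite scaler_sumr -big_split; apply: eq_bigr => t _.
  by rewrite l_lin scalerDl scalerA.
pose L : {linear H -> H} := HB.pack_for {linear H -> H} P (GRing.isLinear.Build k H H _ P P_lin).
(* The span of the monomials, described as the fixed space of the expansion map [P], so that
   membership is the very identity to be proved. *)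
pose W := fixedSpace (linfun L).
have W_mem h : (h \in W) = (P h == h) by rewrite (sameP fixedSpaceP eqP) lfunE.
have mon_mem a c i : mon a c i \in W.
  rewrite W_mem; apply/eqP; have [aN|Na] := ltnP a N; last first.
    have -> : mon a c i = 0 by rewrite /mon -(subnKC Na) exprD xN !mul0r.
    exact: (linear_fun0 P_lin).
  have [cM|Mc] := ltnP c M; last first.
    have -> : mon a c i = 0 by rewrite /mon -(subnKC Mc) exprD yM mul0r mulr0 mul0r.
    exact: (linear_fun0 P_lin).
  have iN : (i %% N < N)%N by rewrite ltn_mod.
  rewrite /P (bigD1 (Ordinal aN, Ordinal cM, Ordinal iN)) //= big1 ?addr0.
    rewrite l_mon /= !eqxx scale1r /mon [in RHS](divn_eq i N) exprD mulnC exprM zN.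
    by rewrite expr1n mul1r.
  case=> [[a' c'] i'] t_neq; rewrite /= l_mon /=.
  case: and3P => [[/eqP Da /eqP Dc /eqP Di]|_]; last by rewrite scale0r.
  by case/eqP: t_neq; congr (_, _, _); apply: val_inj.
have W_sum v : v \in W -> v = \sum_(t : 'I_N * 'I_M * 'I_N) l t.1.1 t.1.2 t.2 v *: mon t.1.1 t.1.2 t.2.
  by rewrite W_mem => /eqP.
have horner_mem a c g : x ^+ a * y ^+ c * horner_alg z g \in W.
  rewrite horner_alg_coef mulr_sumr; apply: memv_suml => j _.
  by rewrite -scalerAr memvZ ?mon_mem.
have yx' : y * x = w *: (x * y) + horner_alg z (al *: ('X^2 - 1)).
  by rewrite horner_algZ rmorphB rmorphXn rmorph1 /= horner_algX.
suff W_all h : h \in W by move=> h; apply: W_sum.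
apply: gen => [|v vW].
  by have := mon_mem 0 0 0; rewrite /mon !expr0 !mulr1.
rewrite [v]W_sum // !mulr_sumr; split; apply: memv_suml => -[[a c] i] _ /=; rewrite -scalerAr memvZ //.
- by rewrite /mon !mulrA -exprS; apply: mon_mem.
- rewrite /mon !mulrA; case: (nat_of_ord a) => [|a'].
    by rewrite expr0 mulr1 -exprS -[y ^+ _]mul1r -(expr0 x); apply: mon_mem.
  have [g ->] := yx_pow zx yx' a'; rewrite !mulrDl memvD // -?scalerAl.
    by rewrite memvZ // -(mulrA _ y) -exprS; apply: mon_mem.
  rewrite -(mulrA _ _ (y ^+ c)) (horner_alg_skewC _ (skewCX c zy)) (mulrA (x ^+ a')).
  by rewrite -(mulrA _ _ (z ^+ i)) -[z ^+ i]horner_algXn -horner_algM.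
- rewrite /mon !mulrA (skewCX a zx) -!scalerAl memvZ // -(mulrA _ z) (skewCX c zy).
  rewrite -scalerAr -scalerAl memvZ // mulrA -(mulrA _ z) -exprS.
  exact: mon_mem.
Qed.

End QuantumPlaneCoordinates.

(** * The two presentations *)

Lemma tensor_mul_pure (k : fieldType) (A B : falgType k) (a c : A) (b d : B) :
  tensor_mul (pure a b) (pure c d) = pure (a * c) (b * d).
Proof.
have [pl pr] := pure_bilinear A B.
rewrite /tensor_mul tensor_lift_pure => [|].
  rewrite tensor_lift_pure //; split=> [v e u u'|u e v v'].
    by rewrite mulrDr -scalerAr pl.
  by rewrite mulrDr -scalerAr pr.
split=> [v e u u'|u e v v']; rewrite -tensor_liftZ -tensor_liftD;
  apply: eq_tensor_lift => f g.
  by rewrite mulrDl -scalerAl pl.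
by rewrite mulrDl -scalerAl pr.
Qed.

Lemma agenv_left_ideal (k : fieldType) (A : falgType k) (s : seq A) (W : {vspace A}) :
    agenv <<s>>%VS = {:A}%VS -> 1 \in W ->
    (forall u v, u \in s -> v \in W -> u * v \in W) ->
  forall h, h \in W.
Proof.
move=> s_gen W1 sW h; have : h \in agenv <<s>>%VS by rewrite s_gen memvf.
apply: subvP; apply: agenv_sub_modl; first by rewrite -memvE.
apply/prodvP => u v su vW; suff /subvP/(_ u su) : (<<s>> <= amulr v @^-1: W)%VS.
  by rewrite -memv_preim lfunE.
by apply/span_subvP => {su}u su; rewrite -memv_preim lfunE /=; apply: sW.
Qed.

(** The scalar is irrelevant: this transfers nilpotency between [F] and [F K]. *)
Lemma skew_mulX (k : fieldType) (A : algType k) (y z : A) (c : k) n :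
  z * y = c *: (y * z) -> exists b, (y * z) ^+ n = b *: (y ^+ n * z ^+ n).
Proof.
move=> zy; elim: n => [|n [b IH]]; first by exists 1; rewrite !expr0 mulr1 scale1r.
exists (b * c ^+ n); rewrite exprSr IH -scalerAl mulrA -(mulrA _ _ y) (skewCXl _ zy).
by rewrite -scalerAr -scalerAl scalerA mulrA -exprSr -mulrA -exprSr.
Qed.

Lemma sum_prim_root (k : fieldType) N (w : k) :
  (1 < N)%N -> N.-primitive_root w -> \sum_(j < N) w ^+ j = 0.
Proof.
move=> N_gt1 w_prim; apply/eqP; have /eqP : (w - 1) * \sum_(j < N) w ^+ j = 0.
  by rewrite -subrX1 (prim_expr_order w_prim) subrr.
rewrite mulf_eq0 subr_eq0 => /orP[/eqP w1|//].
have := prim_order_dvd w_prim 1; rewrite expr1 w1 eqxx dvdn1 => /eqP N1.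
by rewrite N1 in N_gt1.
Qed.

Lemma prim_rootV (k : fieldType) N (w : k) : N.-primitive_root w -> N.-primitive_root w^-1.
Proof.
move=> w_prim; have w_neq0 := prim_root_neq0 w_prim.
have <- : w ^+ N.-1 = w^-1.
  apply: (mulfI w_neq0); rewrite -exprS prednK ?(prim_order_gt0 w_prim) //.
  by rewrite (prim_expr_order w_prim) divff.
by rewrite prim_root_exp_coprime // coprime_sym coprimenP ?(prim_order_gt0 w_prim).
Qed.

(** The conditions on [al] are those that make the representation exist. For [M = N > 1] the
    geometric sums vanish; for [M = 1] they force [al = 0]. *)
Lemma indicator_presented (k : fieldType) (N M : nat) (w al : k) (H : hopfAlgType k)
    (x y z : H) n :
    odd N -> N.-primitive_root w -> (0 < M)%N -> (0 < n)%N ->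
    (gcdn N n)%:R != 0 :> k ->
    al * \sum_(j < N) w ^+ j = 0 -> al * \sum_(j < M) w ^+ j = 0 ->
    al * \sum_(j < M) w^-1 ^+ j = 0 ->
    quantum_plane_relations N M w al x y z ->
    (forall (A : algType k) (X Y Z : A), quantum_plane_relations N M w al X Y Z ->
       exists phi : {lrmorphism H -> A}, [/\ phi x = X, phi y = Y & phi z = Z]) ->
    (forall W : {vspace H}, 1 \in W ->
       (forall v, v \in W -> [/\ x * v \in W, y * v \in W & z * v \in W]) ->
       forall h, h \in W) ->
    comul H z = pure z z -> comul H x = pure x 1 + pure z x ->
    comul H y = pure y 1 + pure z y ->
  indicator H n = (gcdn N n)%:R^-1 *
    ((\sum_(a < N) taft_term w N n a) * (\sum_(c < M) taft_term w^-1 N n c)).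
Proof.
move=> N_odd w_prim M_gt0 n_gt0 d_neq0 al_N al_M al_M' rels univ gen Dz Dx Dy.
have N_gt0 := prim_order_gt0 w_prim; have wN := prim_expr_order w_prim.
have [l [l_lin l_mon l_dec]] :=
  quantum_plane_coordinates N_gt0 M_gt0 wN al_N al_M al_M' rels univ gen.
have [[_ _ zN] [zx zy yx]] := rels.
apply: (indicator_quantum_plane N_gt0 wN zN zx zy _ Dz Dx Dy l_lin l_mon l_dec) => //.
by rewrite yx; congr (_ + _); rewrite -[z ^+ 2]horner_algXn -(rmorph1 (horner_alg z)) -rmorphB -horner_algZ.
Qed.

Lemma sweedler_poly0 (k : fieldType) (w : k) m : sweedler_poly w m 0 = 1.
Proof.
elim: m => [|m IH] //=.
by rewrite big_ord1 IH mul1r scale1r expr0 mulr1.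
Qed.

Lemma taft_term0 (k : fieldType) (w : k) N n : (0 < N)%N -> taft_term w N n 0 = (gcdn N n)%:R.
Proof.
move=> N_gt0; rewrite /taft_term sweedler_poly0 size_poly1 big_ord1 coef1 eqxx !mul1r.
have := count_linear_congruence k n N_gt0 0; rewrite dvdn0 => <-.
by apply: eq_bigr => i _; rewrite muln0 expr0 mul1r.
Qed.

Lemma indicator_taft (k : fieldType) (N : nat) (w : k) (T : hopfAlgType k) (x g : T) n :
    odd N -> N.-primitive_root w -> (0 < n)%N -> (gcdn N n)%:R != 0 :> k ->
    is_taft N w x g ->
  indicator T n = \sum_(a < N) taft_term w N n a.
Proof.
move=> N_odd w_prim n_gt0 d_neq0 [T_gen [xN gN gx] univ [Dx Dg]].
have N_gt0 := prim_order_gt0 w_prim; have [pl pr] := pure_bilinear T T.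
rewrite (@indicator_presented _ N 1 w 0 T x 0 g) ?mul0r //.
(* With [M = 1] the second sum has the single term [c = 0], equal to [gcd(N, n)], which cancels the
   prefactor. *)
- by rewrite big_ord1 taft_term0 // mulrCA mulVf // mulr1.
- by split; split; rewrite ?expr1 ?mul0r ?mulr0 ?scaler0 ?scale0r ?addr0.
- move=> A X Y Z [[XN Y0 ZN] [ZX _ _]].
  have [phi [phix phig]] := univ A X Z (And3 XN ZN ZX).
  by exists phi; split=> //; rewrite rmorph0 -[Y]expr1.
- move=> W W1 W_closed; apply: agenv_left_ideal T_gen W1 _ => u v.
  by rewrite !inE => /orP[] /eqP -> /W_closed[].
by rewrite linear0 (linear_fun0 (pl 1)) (linear_fun0 (pr g)) addr0.
Qed.

Section QuantumSl2.
Variables (k : fieldType) (N : nat) (q : k).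
Hypotheses (N_gt1 : (1 < N)%N) (w_prim : N.-primitive_root (q ^+ 2)).
Local Notation w := (q ^+ 2).
Local Notation kappa := (q - q^-1)^-1.
Local Notation al := (- (w * kappa)).

Let w_neq0 := prim_root_neq0 w_prim.
Let N_gt0 := prim_order_gt0 w_prim.
Let wVN : w ^+ N.-1 = w^-1.
Proof. by apply: (mulfI w_neq0); rewrite -exprS prednK // (prim_expr_order w_prim) divff. Qed.

(** The constant [al] comes from [F K E = q^2 F E K = q^2 (E F - kappa (K - K^-1)) K]. *)
Lemma uqsl2_quantum_plane (A : algType k) (E F K : A) :
  uqsl2_relations N q E F K -> quantum_plane_relations N N w al E (F * K) K.
Proof.
case=> [[EN FN KN] [KE KF EF]].
have KNK : K ^+ N.-1 * K = 1 by rewrite -exprSr prednK.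
split; split=> //.
- by have [b ->] := skew_mulX N KF; rewrite FN mul0r scaler0.
- by rewrite mulrA KF -scalerAl.
have FE : F * E = E * F - kappa *: (K - K ^+ N.-1).
  by rewrite -EF opprB addrC subrK.
rewrite -(mulrA F) KE -scalerAr (mulrA F) FE mulrBl scalerBr -(mulrA E); congr (_ + _).
by rewrite -scalerAl scalerA -scaleNr mulrBl KNK -expr2.
Qed.

Lemma quantum_plane_uqsl2 (A : algType k) (X Y Z : A) :
  quantum_plane_relations N N w al X Y Z ->
  uqsl2_relations N q X (Y * Z ^+ N.-1) Z.
Proof.
case=> [[XN YN ZN] [ZX ZY YX]].
have ZNZ : Z ^+ N.-1 * Z = 1 by rewrite -exprSr prednK.
split; split=> //.
- by have [b ->] := skew_mulX N (skewCXl N.-1 ZY); rewrite YN mul0r scaler0.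
- by rewrite mulrA ZY -scalerAl -!mulrA -exprS -exprSr.
rewrite -(mulrA Y) (skewCXl _ ZX) wVN -scalerAr (mulrA Y) YX mulrDl scalerDr -!scalerAl !scalerA.
rewrite mulVf // scale1r mulrA opprD addrA subrr add0r -scaleNr mulrN opprK mulrA mulVf // mul1r.
by rewrite mulrBl mul1r expr2 -mulrA -exprS prednK // ZN mulr1.
Qed.

Lemma indicator_uqsl2 (U : hopfAlgType k) (E F K : U) n :
    odd N -> (0 < n)%N -> (gcdn N n)%:R != 0 :> k -> is_uqsl2 N q E F K ->
  indicator U n = (gcdn N n)%:R^-1 *
    ((\sum_(a < N) taft_term w N n a) * (\sum_(c < N) taft_term w^-1 N n c)).
Proof.
move=> N_odd n_gt0 d_neq0 [U_gen rels univ [DE DF DK]].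
have [[EN FN KN] _] := rels; have [pl pr] := pure_bilinear U U.
have KNK : K ^+ N.-1 * K = 1 by rewrite -exprSr prednK.
have K_unit : K \is a GRing.unit.
  by apply/unitrP; exists (K ^+ N.-1); rewrite KNK -exprS prednK.
apply: (@indicator_presented _ N N w al U E (F * K) K) => //.
- by rewrite sum_prim_root // mulr0.
- by rewrite sum_prim_root // mulr0.
- by rewrite sum_prim_root ?mulr0 //; apply: prim_rootV.
- exact: uqsl2_quantum_plane.
- move=> A X Y Z XYZ; have [phi [phiE phiF phiK]] := univ _ _ _ _ (quantum_plane_uqsl2 XYZ).
  exists phi; split=> //; rewrite rmorphM /= phiF phiK -mulrA -exprSr prednK //.
  by have [[_ _ ->] _] := XYZ; rewrite mulr1.
- move=> W W1 W_closed; have W_K m v : v \in W -> K ^+ m * v \in W.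
    by elim: m v => [|m IH] v vW; rewrite ?mul1r // exprSr -mulrA; apply: IH; have [] := W_closed v vW.
  apply: agenv_left_ideal U_gen W1 _ => u v; rewrite !inE => /or3P[] /eqP -> vW.
  + by have [] := W_closed v vW.
  (* [F] is recovered as [(F K) K^(N-1)], and [W] is stable under both factors. *)
  + have [_ ? _] := W_closed _ (W_K N.-1 v vW).
    by rewrite -[v]mul1r -KN -[N](prednK N_gt0) exprS -mulrA mulrA.
  + by have [] := W_closed v vW.
(* Multiplying by the grouplike [K] turns the coproduct of [F] into the same skew-primitive form as
   that of [E]. *)
rewrite comulM DF DK /tensor_mul linearD /= -!/(tensor_mul _ _).
by rewrite !tensor_mul_pure mulVr // mul1r.
Qed.

End QuantumSl2.

Theorem theorem6p5 (k : closedFieldType) (char0 : [pchar k] =i pred0)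
  (N : nat) (N_odd : odd N) (N_gt1 : (1 < N)%N)
  (q : k) (q_order : N.-primitive_root q)
  (U : hopfAlgType k) (E F K : U) (hU : is_uqsl2 N q E F K)
  (T : hopfAlgType k) (x g : T) (hT : is_taft N (q ^+ 2) x g)
  (n : nat) (n_gt0 : (0 < n)%N) :
  indicator U n = (gcdn N n)%:R^-1 * cyc_normsq (indicator T n).
Proof.
(* Squaring preserves the order because [N] is odd. *)
have w_prim : N.-primitive_root (q ^+ 2).
  by rewrite prim_root_exp_coprime // coprime2n.
have N_gt0 := prim_order_gt0 w_prim.
have d_neq0 : (gcdn N n)%:R != 0 :> k.
  by apply: natr_char0_neq0 => //; rewrite gcdn_gt0 N_gt0.
rewrite (indicator_uqsl2 N_gt1 w_prim N_odd n_gt0 d_neq0 hU) /cyc_normsq.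
rewrite (indicator_taft N_odd w_prim n_gt0 d_neq0 hT); congr (_ * (_ * _)).
apply/esym/(cyc_conjE char0)/cyclotomic_conjugate_sum => a.
by apply: taft_term_conjugate; exists N; rewrite ?(prim_expr_order w_prim).
Qed.
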